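(* Let $S=\Bbbk[x_1,\ldots,x_n]$ with $\Bbbk$ an infinite field, and let $\mathfrak{a}=\mathfrak{f}+(G)$ be an almost complete intersection of degrees $(\mathbf{d};D)=(d_1,\ldots,d_h;D)$. If $D\le \sigma=\sum_{i=1}^h(d_i-1)$, then there exists an Artinian almost complete intersection $\overline{\mathfrak{a}}\subseteq \overline{S}=\Bbbk[x_1,\ldots,x_h]$ of degrees $(\mathbf{d};D)$ such that $\operatorname{HF}(S/\mathfrak{a};j)\le \operatorname{HF}(S/\overline{\mathfrak{a}}S;j)$ for all $j\in\mathbb{Z}$. In particular, $\operatorname{e}(S/\mathfrak{a})\le \operatorname{e}(\overline{S}/\overline{\mathfrak{a}})$.
   Context: $S$ is standard graded; $\operatorname{HF}(M;j)=\dim_\Bbbk M_j$ and $\operatorname{e}(M)$ is the multiplicity. A homogeneous ideal $\mathfrak{a}\subseteq S$ is an almost complete intersection of degrees $(\mathbf{d};D)=(d_1,\ldots,d_h;D)$ if $\operatorname{ht}(\mathfrak{a})=h$ and $\mathfrak{a}=\mathfrak{f}+(G)$, where $\mathfrak{f}=(f_1,\ldots,f_h)$ is generated by a homogeneous regular sequence of degrees $d_1\le\cdots\le d_h$ and $G$ is a homogeneous element of degree $D$ with $G\notin\mathfrak{f}$ ($\mathfrak{a}$ need not be minimally generated by $h+1$ elements). *)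

(* Defs.v *)
From HB Require Import structures.
From mathcomp Require Import all_boot all_order all_algebra.
From mathcomp Require Import mpoly.
From Stdlib Require Import ClassicalEpsilon.
Set Implicit Arguments. Unset Strict Implicit. Unset Printing Implicit Defensive.
Import Order.TTheory GRing.Theory Num.Theory.
Local Open Scope ring_scope.

Section CommAlg.
Variables (K : fieldType) (n : nat).
Local Notation S := {mpoly K[n]}.

Definition subI (I J : S -> Prop) := forall x, I x -> J x.
Definition ssubI (I J : S -> Prop) := subI I J /\ exists x, J x /\ ~ I x.

Definition ideal_gen (s : seq S) : S -> Prop :=
  fun p => exists c : 'I_(size s) -> S, p = \sum_(i < size s) c i * s`_i.

Definition is_ideal (I : S -> Prop) :=
  [/\ I 0, (forall x y, I x -> I y -> I (x + y)) & (forall r x, I x -> I (r * x))].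

Definition is_prime (P : S -> Prop) :=
  [/\ is_ideal P, ~ P 1 & forall x y, P (x * y) -> P x \/ P y].

Definition prime_chain (c : nat -> S -> Prop) (L : nat) :=
  (forall i, (i <= L)%N -> is_prime (c i)) /\
  (forall i, (i < L)%N -> ssubI (c i) (c i.+1)).

Definition ht_ge (P : S -> Prop) (L : nat) :=
  exists c, prime_chain c L /\ c L = P.

Definition height_eq (I : S -> Prop) (h : nat) :=
  (forall P, is_prime P -> subI I P -> ht_ge P h) /\
  (exists P, [/\ is_prime P, subI I P & ~ ht_ge P h.+1]).

Definition dim_ge (I : S -> Prop) (L : nat) :=
  exists c, prime_chain c L /\ subI I (c 0%N).
Definition krull_dim_eq (I : S -> Prop) (d : nat) :=
  dim_ge I d /\ ~ dim_ge I d.+1.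

Definition artinian (I : S -> Prop) := krull_dim_eq I 0.

Definition regular_seq (fs : seq S) :=
  ~ ideal_gen fs 1 /\
  forall i, (i < size fs)%N -> forall p,
    ideal_gen (take i fs) (p * fs`_i) -> ideal_gen (take i fs) p.

Definition aci_ideal (fs : seq S) (G : S) := ideal_gen (rcons fs G).

Definition is_aci (fs : seq S) (G : S) (d : seq nat) (D : nat) :=
  [/\ size fs = size d, sorted leq d,
      (forall i, (i < size fs)%N -> fs`_i \is (nth 0%N d i).-homog) & regular_seq fs] /\
  [/\ G \is D.-homog, ~ ideal_gen fs G & height_eq (aci_ideal fs G) (size d)].

Definition indep_mod (I : S -> Prop) (j r : nat) :=
  exists p : 'I_r -> S, (forall i, p i \is j.-homog) /\
    forall c : 'I_r -> K, I (\sum_(i < r) c i *: p i) -> forall i, c i = 0.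

Definition bool_of (P : Prop) : bool :=
  if excluded_middle_informative P then true else false.

(* HF(S/I; j) = dim_K (S/I)_j for a homogeneous ideal I; the bound
   'C(j+n, n) is >= dim_K S_j, the number of monomials of degree j *)
Definition HF (I : S -> Prop) (j : int) : nat :=
  match j with
  | Posz m => \max_(r < 'C(m + n, n).+1 | bool_of (indep_mod I m r)) r
  | Negz _ => 0%N
  end.

(* multiplicity via Hilbert-Samuel: e(S/I) = lim_j d! * (sum_(i<=j) HF(i)) / j^d,
   d = dim S/I *)
Definition multiplicity_is (I : S -> Prop) (e : nat) :=
  exists dd : nat, krull_dim_eq I dd /\
   forall eps : rat, 0 < eps -> exists N : nat, forall j : nat, (N <= j)%N ->
     `| ((dd`!)%:R * (\sum_(i < j.+1) HF I (Posz i))%:R / (j%:R ^+ dd)) - e%:R | < eps.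

End CommAlg.

(* extension of polynomials along K[x_1..x_h] -> K[x_1..x_n], x_i |-> x_i
   (variables with index >= n, which never occur when h <= n, go to 0) *)
Definition ext_var (K : fieldType) (h n : nat) (i : 'I_h) : {mpoly K[n]} :=
  match insub (val i) with Some j => 'X_j | None => 0 end.

Definition ext_poly (K : fieldType) (h n : nat) (p : {mpoly K[h]}) : {mpoly K[n]} :=
  comp_mpoly [tuple ext_var K n i | i < h] p.

Definition sigma (d : seq nat) : int := \sum_(x <- d) (x%:Z - 1).

(* Main.v *)
(* Let [I = (f)] be generated by the regular sequence.  Since [K] is infinite, a counting
   argument provides linear forms [l] such that [f, l] is a regular sequence of length [n];
   the socle of [S/(f, l)] sits in degree [sigma], because exchanging [f_i] for a linear
   form shifts socle degrees by [d_i - 1].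
   From [HF(S/(I + (G)); j) = HF(S/I; j) - HF(S/(I : G); j - D)] we must bound
   [HF(S/(I : G))] from below.  Cut by one [l] at a time.  If [G = l G1] modulo [I], then
   [I : G = I : G1], so [G] may be assumed nonzero modulo [I + (l)]; and
   [(I : G) + (l)] is contained in [(I + (l)) : G].  This ends with a form [G'] outside
   [(f, l)] of degree at most [D]; as [D <= sigma], the socle allows multiplying [G'] up to
   degree [D] without falling into [(f, l)], which only enlarges the colon ideal.
   For the multiplicities one needs [dim S/a >= n - h]: a prime [P] over [a] with no chain of
   length [h + 1] below it is free of relations among some [n - h] variables, and a chain of
   primes above [P] is then obtained by making these variables algebraic one at a time. *)
Require Import Defs.
From HB Require Import structures.
From mathcomp Require Import all_boot all_order all_algebra.
From mathcomp Require Import perm mpoly.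
From mathcomp Require Import zify ring.
From mathcomp Require classical_sets.
From Stdlib Require Import ClassicalEpsilon.
From Stdlib Require FunctionalExtensionality PropExtensionality.
Set Implicit Arguments. Unset Strict Implicit. Unset Printing Implicit Defensive.
Import Order.TTheory GRing.Theory Num.Theory.
Local Open Scope ring_scope.

(** * Hilbert functions as codimensions *)

(** The colon estimate has two sides that meet in the Artinian ring. Each form of [ls] is a
    nonzerodivisor, so cutting bounds [HF (colon I G)] from below by an iterated sum of Artinian
    values. For the ideal [E] extended from [h] variables, cutting its colon by the last [n - h]
    variables bounds that Hilbert function from above by the same iterated sum. The Hilbert
    functions of [S/I] and [S/E] agree because they depend only on the degrees of the regular
    sequences. The counting argument compares orders of growth: with [k + 1] parameters left, degree
    [N] of [S/(I + (g))] has dimension of smaller order than [N^k], the order of the number of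
    monomials of degree [N] in [k + 1] variables. The length of the second half is due to Krull
    dimension being defined by chains of primes: a Hilbert function gives no such chain, so the
    primes have to be built. Chains are bounded above by counting independent products of bounded
    degree, and produced from below by contracting and extending along variables, or by Zorn's
    lemma. *)

Arguments HF : simpl never.

Notation "''pi_' d p" := (pihomog mdeg d p)
  (at level 10, d at level 2, p at level 9, format "''pi_' d  p").

(** Ideals are bare predicates here, and this classical step turns their graded pieces into vector
    spaces: enlarge [U] by a vector of [P] outside it until none is left. The codimension, bounded
    by [k], makes this stop. *)
Lemma subspace_of_pred (K : fieldType) (V : vectType K) (P : V -> Prop) :
  P 0 -> (forall c x y, P x -> P y -> P (c *: x + y)) ->
  exists U : {vspace V}, forall v, v \in U <-> P v.
Proof.
move=> P0 PL.
suff H k : forall U : {vspace V}, (\dim {:V} - \dim U < k)%N ->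
    (forall v, v \in U -> P v) -> exists U : {vspace V}, forall v, v \in U <-> P v.
  by apply: (H _ 0%VS (ltnSn _)) => v; rewrite memv0 => /eqP ->.
elim: k => [//|k IH] U dU UP.
case: (classic (exists2 v, P v & v \notin U)) => [[v Pv vU]|N]; last first.
  exists U => v; split=> [/UP //|Pv].
  by case: (boolP (v \in U)) => // vU; case: N; exists v.
apply: (IH (<[v]> + U)%VS) => [|w /memv_addP [_ /vlineP [c ->] [u uU ->]]].
- have lt: (\dim U < \dim (<[v]> + U))%N.
    rewrite ltn_neqAle dimvS ?addvSr // andbT (dimv_leqif_sup (addvSr _ _)).2.
    by rewrite subv_add subvv andbT -memvE.
  have := dimvS (subvf (<[v]> + U)%VS); lia.
- by apply: PL => //; apply: UP.
Qed.

Section Monomials.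
Variables (K : fieldType) (n : nat).
Implicit Types (p q : {mpoly K[n]}).

Definition monos d : seq 'X_{1..n} :=
  [seq s2m t | t : d.-tuple 'I_n <- enum (basis n d)].

Lemma mem_monos d m : (m \in monos d) = (mdeg m == d).
Proof. by rewrite basis_cover. Qed.

Lemma uniq_monos d : uniq (monos d).
Proof. exact: uniq_basis. Qed.

(** Row vectors over the monomials of degree [d] model the graded piece, since the polynomial ring
    itself is not finite dimensional. *)
Definition of_coefs d (v : 'rV[K]_(size (monos d))) : {mpoly K[n]} :=
  \sum_(i < size (monos d)) v 0 i *: 'X_[nth 0%MM (monos d) i].

Definition to_coefs d p : 'rV[K]_(size (monos d)) :=
  \row_(i < size (monos d)) p@_(nth 0%MM (monos d) i).

Lemma of_coefs_is_linear d : linear (@of_coefs d).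
Proof.
move=> c u v; rewrite /of_coefs scaler_sumr -big_split /=; apply: eq_bigr => i _.
by rewrite !mxE scalerDl scalerA.
Qed.
HB.instance Definition _ d := GRing.isLinear.Build K _ _ _ _ (@of_coefs_is_linear d).

Lemma to_coefs_is_linear d : linear (@to_coefs d).
Proof. by move=> c p q; apply/rowP => i; rewrite !mxE mcoeffD mcoeffZ. Qed.
HB.instance Definition _ d := GRing.isLinear.Build K _ _ _ _ (@to_coefs_is_linear d).

Lemma of_coefs_homog d v : @of_coefs d v \is d.-homog.
Proof.
apply: rpred_sum => i _; apply: rpredZ; rewrite dhomogX -mem_monos.
exact: mem_nth.
Qed.

Lemma of_coefsK d : cancel (@of_coefs d) (@to_coefs d).
Proof.
move=> v; apply/rowP => i; rewrite mxE raddf_sum /= (bigD1 i) //=.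
rewrite mcoeffZ mcoeffX eqxx mulr1 big1 ?addr0 // => j ne.
by rewrite mcoeffZ mcoeffX nth_uniq ?uniq_monos // val_eqE (negbTE ne) mulr0.
Qed.

Lemma to_coefsK d p : p \is d.-homog -> of_coefs (to_coefs d p) = p.
Proof.
move=> hp; apply/mpolyP => m; rewrite raddf_sum /=.
case: (boolP (mdeg m == d)) => [md|nmd]; last first.
  rewrite (dhomog_nemf_coeff hp nmd) big1 // => i _.
  rewrite mcoeffZ mcoeffX; case: eqP => [E|]; last by rewrite mulr0.
  by case/negP: nmd; rewrite -mem_monos -E mem_nth.
have mi : m \in monos d by rewrite mem_monos.
have lt : (index m (monos d) < size (monos d))%N by rewrite index_mem.
rewrite (bigD1 (Ordinal lt)) //= mxE mcoeffZ mcoeffX nth_index // eqxx mulr1.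
rewrite big1 ?addr0 // => j ne.
rewrite mcoeffZ mcoeffX; case: eqP => [E|]; last by rewrite mulr0.
case/negP: ne; rewrite -val_eqE /= -E index_uniq ?uniq_monos //.
Qed.

End Monomials.

Lemma size_monosS n d : size (monos n.+1 d) = 'C(d + n, n).
Proof. by rewrite size_basis -bin_sub ?leq_addr // addKn. Qed.

Lemma size_monos0 d : size (monos 0 d) = (d == 0%N).
Proof.
case: d => [|d] /=.
  apply/eqP; rewrite eqn_leq; apply/andP; split; last first.
    by rewrite -has_predT; apply/hasP; exists 0%MM => //; rewrite mem_monos mdeg0.
  have := uniq_leq_size (@uniq_monos 0 0) (s2 := [:: 0%MM]); apply.
  by move=> m _; rewrite inE; apply/eqP/mnmP; case.
rewrite -[monos 0 d.+1]/(monos 0 d.+1); case E: (monos 0 d.+1) => [//|m s].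
have: m \in monos 0 d.+1 by rewrite E inE eqxx.
by rewrite mem_monos mdegE big_ord0.
Qed.

(** Ensures that the range of the maximum in [HF] reaches the true codimension. *)
Lemma size_monos_le n d : (size (monos n d) <= 'C(d + n, n))%N.
Proof.
case: n => [|n]; first by rewrite size_monos0 bin0; case: (d == 0%N).
by rewrite size_monosS addnS binS leq_addl.
Qed.

(** Weaker than being an ideal, because rank-nullity applies [HF] to preimages and images of linear
    maps, which are only subspaces. *)
Definition lin_closed (K : fieldType) n (I : {mpoly K[n]} -> Prop) :=
  I 0 /\ forall c x y, I x -> I y -> I (c *: x + y).

Section HilbertFunction.
Variables (K : fieldType).

Section Spec.
Variable (n : nat).
Implicit Types (I J : {mpoly K[n]} -> Prop) (d : nat).

(** An independent family modulo [I] spans an [r]-dimensional space that meets [U] trivially;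
    conversely, [r] vectors from a basis of a complement of [U] are independent modulo [I]. *)
Lemma indep_modP I d (U : {vspace 'rV[K]_(size (monos n d))}) r :
  (forall v, v \in U <-> I (of_coefs v)) ->
  indep_mod I d r <-> (r + \dim U <= size (monos n d))%N.
Proof.
move=> UI; set V := 'rV[K]_(size (monos n d)) in U UI *.
have dV : \dim {:V} = size (monos n d) by rewrite dimvf /dim /= mul1n.
split=> [[p [hp pI]]|le].
  pose F (c : 'rV[K]_r) : V := \sum_(i < r) c 0 i *: to_coefs d (p i).
  have Flin : linear F.
    move=> a u v; rewrite /F scaler_sumr -big_split /=; apply: eq_bigr => i _.
    by rewrite !mxE scalerDl scalerA.
  pose FL := GRing.isLinear.Build K _ _ _ F Flin.
  pose Fl : {linear 'rV[K]_r -> V} := HB.pack F FL.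
  pose f := linfun Fl.
  have fE c : f c = F c by rewrite lfunE.
  have ofF c : of_coefs (F c) = \sum_(i < r) c 0 i *: p i.
    rewrite /F linear_sum /=; apply: eq_bigr => i _.
    by rewrite linearZ /= to_coefsK.
  have fU c : f c \in U -> c = 0.
    move/UI; rewrite fE ofF => /(pI (fun i => c 0 i)) H.
    by apply/rowP => i; rewrite mxE H.
  have ker0 : lker f = 0%VS.
    apply/eqP; rewrite -subv0; apply/subvP => c.
    by rewrite memv_ker => /eqP E; rewrite memv0 (fU c) // E mem0v.
  have cap : (limg f :&: U)%VS = 0%VS.
    apply/eqP; rewrite -subv0; apply/subvP => v; rewrite memv_cap.
    case/andP => /memv_imgP [c _ ->] /fU ->; by rewrite linear0 mem0v.
  have := dimvS (subvf (limg f + U)%VS).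
  rewrite (dimv_disjoint_sum cap) limg_dim_eq ?ker0 ?capv0 //.
  by rewrite dV dimvf /dim /= mul1n.
have dC : \dim (U^C)%VS = (size (monos n d) - \dim U)%N by rewrite dimv_compl dV.
have ler : (r <= \dim (U^C))%N by rewrite dC; lia.
have sz : size (take r (vbasis (U^C)%VS)) == r by rewrite size_takel ?size_tuple.
pose b := Tuple sz.
have fr : free b.
  by apply: (@catl_free _ _ (drop r (vbasis (U^C)%VS))); rewrite cat_take_drop (basis_free (vbasisP _)).
exists (fun i => of_coefs b`_i); split=> [i|c]; first exact: of_coefs_homog.
move=> Ic; move/freeP: fr; apply.
have E : of_coefs (\sum_(i < r) c i *: b`_i) = \sum_(i < r) c i *: of_coefs b`_i.
  by rewrite linear_sum; apply: eq_bigr => j _; rewrite linearZ.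
move: Ic; rewrite -E => /UI inU.
have inC : \sum_(i < r) c i *: b`_i \in (U^C)%VS.
  apply: rpred_sum => j _; apply: rpredZ; apply: vbasis_mem.
  by apply: (@mem_take r); apply: mem_nth; rewrite (eqP sz).
have : \sum_(i < r) c i *: b`_i \in (U :&: U^C)%VS by rewrite memv_cap inU.
by rewrite capv_compl memv0 => /eqP.
Qed.

Lemma bool_ofE (P : Prop) : bool_of P <-> P.
Proof. by rewrite /bool_of; case: excluded_middle_informative; split. Qed.

Lemma HF_codim I d (U : {vspace 'rV[K]_(size (monos n d))}) :
  (forall v, v \in U <-> I (of_coefs v)) ->
  (HF I d + \dim U)%N = size (monos n d).
Proof.
move=> UI.
have dU : (\dim U <= size (monos n d))%N.
  by have := dimvS (subvf U); rewrite dimvf /dim /= mul1n.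
suff -> : HF I d = (size (monos n d) - \dim U)%N by rewrite subnK.
apply/eqP; rewrite eqn_leq; apply/andP; split.
  apply/bigmax_leqP => r /bool_ofE /(indep_modP _ UI); lia.
have lt : (size (monos n d) - \dim U < 'C(d + n, n).+1)%N.
  by have := size_monos_le n d; lia.
rewrite /HF (bigD1 (Ordinal lt)) ?leq_maxl //=.
by apply/bool_ofE/(indep_modP _ UI); rewrite subnK.
Qed.

Lemma HF_subspace I d : lin_closed I ->
  exists2 U : {vspace 'rV[K]_(size (monos n d))},
    (forall v, v \in U <-> I (of_coefs v)) & (HF I d + \dim U)%N = size (monos n d).
Proof.
case=> I0 IL.
have [||U UI] := @subspace_of_pred _ _ (fun v => I (@of_coefs K n d v)).
- by rewrite linear0.
- by move=> c x y Ix Iy; rewrite linearP; apply: IL.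
by exists U => //; apply: HF_codim.
Qed.

Lemma HF0_in I d p : lin_closed I -> HF I d = 0%N -> p \is d.-homog -> I p.
Proof.
move=> /(HF_subspace d) [U UI]; move=> E H0 hp.
rewrite H0 add0n in E.
have Uf : U = fullv.
  by apply/eqP; rewrite eqEdim subvf E dimvf /dim /= mul1n.
by rewrite -(to_coefsK hp); apply/UI; rewrite Uf memvf.
Qed.

Lemma HF_full I d : lin_closed I -> (forall p, p \is d.-homog -> I p) -> HF I d = 0%N.
Proof.
move=> /(HF_subspace d) [U UI E] H.
have Uf : U = fullv.
  apply/eqP; rewrite eqEsubv subvf; apply/subvP => v _.
  by apply/UI/H/of_coefs_homog.
by move: E; rewrite Uf dimvf /dim /= mul1n; lia.
Qed.

Lemma HF_mono I J d : lin_closed I -> lin_closed J ->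
  (forall p, p \is d.-homog -> I p -> J p) -> (HF J d <= HF I d)%N.
Proof.
move=> /(HF_subspace d) [U UI EU] /(HF_subspace d) [W WJ EW] H.
have /dimvS : (U <= W)%VS.
  by apply/subvP => v /UI Iv; apply/WJ/H => //; apply: of_coefs_homog.
lia.
Qed.

Lemma HF_eq I J d : lin_closed I -> lin_closed J ->
  (forall p, p \is d.-homog -> I p <-> J p) -> HF I d = HF J d.
Proof.
move=> lI lJ H; apply/eqP; rewrite eqn_leq.
by rewrite !HF_mono // => p /H [].
Qed.

End Spec.

(* rank-nullity for [S_d -> (S'/I)_e], [p |-> F p] *)
Lemma HF_rank_nullity n m (I : {mpoly K[m]} -> Prop)
    (F : {linear {mpoly K[n]} -> {mpoly K[m]}}) (d e : nat) :
  lin_closed I -> (forall p, p \is d.-homog -> F p \is e.-homog) ->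
  (HF (fun p => I (F p)) d +
   HF (fun q => exists2 p, p \is d.-homog & I (q - F p)%R) e)%N = HF I e.
Proof.
move=> lI hF; have [U UI EU] := HF_subspace e lI.
pose g v := to_coefs e (F (@of_coefs K n d v)).
have glin : linear g by move=> c u v; rewrite /g !linearP.
pose GL := GRing.isLinear.Build K _ _ _ g glin.
pose Gl : {linear 'rV[K]_(size (monos n d)) -> 'rV[K]_(size (monos m e))} :=
  HB.pack g GL.
have [f fE] : exists f : 'Hom('rV[K]_(size (monos n d)), 'rV[K]_(size (monos m e))),
    forall v, of_coefs (f v) = F (of_coefs v).
  by exists (linfun Gl) => v; rewrite lfunE /= /g to_coefsK // hF // of_coefs_homog.
have E1 : (HF (fun p => I (F p)) d + \dim (f @^-1: U)%VS)%N = size (monos n d).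
  apply: HF_codim => v; rewrite -memv_preim -fE; exact: UI.
have E2 : (HF (fun q => exists2 p, p \is d.-homog & I (q - F p)%R) e
            + \dim (U + limg f)%VS)%N = size (monos m e).
  apply: HF_codim => v; split.
    case/memv_addP => u uU [_ /memv_imgP [w _ ->] ->].
    exists (of_coefs w); first exact: of_coefs_homog.
    by rewrite linearD /= fE addrK; apply/UI.
  case=> p hp Ip; rewrite -[v](subrK (f (to_coefs d p))).
  apply: memv_add; last by apply: memv_img; apply: memvf.
  by apply/UI; rewrite linearB /= fE to_coefsK.
(* The preimage of [U] contains the whole kernel of [f], and its image is [U :&: limg f]; together
   with [E4] and [E5] only arithmetic remains. *)
have E3 := limg_ker_dim f (f @^-1: U)%VS.
rewrite (capv_idPr _) in E3; last first.
  by apply/subvP => v; rewrite memv_ker -memv_preim => /eqP ->; rewrite mem0v.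
rewrite -lpreim_cap_limg lpreimK ?capvSr // lpreim_cap_limg in E3.
have E4 := limg_ker_dim f fullv.
rewrite capfv dimvf /dim /= mul1n in E4.
have E5 := dimv_sum_cap U (limg f).
have arith (a1 a2 c1 c2 k r c u N M h : nat) : (a1 + a2 = N -> c1 + c2 = M ->
  k + c = a2 -> k + r = N -> c2 + c = u + r -> h + u = M -> a1 + c1 = h)%N by lia.
exact: arith E1 E2 E3 E4 E5 EU.
Qed.

End HilbertFunction.

(** * Ideals and regular sequences *)

Section Ideals.
Variables (K : fieldType) (n : nat).
Local Notation S := {mpoly K[n]}.
Implicit Types (I J : S -> Prop) (p q x y : S) (s t : seq S).

Definition homog_ideal I := is_ideal I /\ forall p d, I p -> I ('pi_d p).
Definition zero_ideal : S -> Prop := fun p => p = 0.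
(** Generators are adjoined one at a time to an arbitrary base ideal, so that inductions along a
    sequence may change the base. *)
Definition add_gen I x : S -> Prop := fun p => exists i r, I i /\ p = i + r * x.
Definition add_gens I s : S -> Prop := foldl add_gen I s.
Definition colon I x : S -> Prop := fun p => I (p * x).
Definition nzd I x := forall p, I (p * x) -> I p.
(** Properness is kept apart, so that the notion splits along concatenation ([reg_cat]);
    [add_gens_proper] supplies it for elements of positive degree. *)
Fixpoint reg I s := if s is x :: s' then nzd I x /\ reg (add_gen I x) s' else True.

Lemma pred_ext I J : (forall p, I p <-> J p) -> I = J.
Proof.
move=> H; apply: FunctionalExtensionality.functional_extensionality => p.
exact/PropExtensionality.propositional_extensionality.
Qed.

Lemma idealN I p : is_ideal I -> I p -> I (- p).
Proof. by case=> _ _ H Ip; rewrite -mulN1r; apply: H. Qed.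

Lemma idealB I p q : is_ideal I -> I p -> I q -> I (p - q).
Proof. by move=> iI Ip Iq; case: (iI) => _ D _; apply: D => //; apply: idealN. Qed.

Lemma idealD I p q : is_ideal I -> I p -> I q -> I (p + q).
Proof. by case=> _ D _; apply: D. Qed.

Lemma idealMl I p q : is_ideal I -> I q -> I (p * q).
Proof. by case=> _ _; apply. Qed.

Lemma idealMr I p q : is_ideal I -> I p -> I (p * q).
Proof. by rewrite mulrC; apply: idealMl. Qed.

Lemma ideal_sum I (T : Type) (r : seq T) (P : pred T) (F : T -> S) : is_ideal I ->
  (forall i, P i -> I (F i)) -> I (\sum_(i <- r | P i) F i).
Proof. by move=> iI H; apply: big_ind => //; [case: iI | move=> *; apply: idealD]. Qed.

Lemma ideal_lin I : is_ideal I -> lin_closed I.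
Proof.
case=> I0 D M; split=> // c x y Ix Iy; apply: D => //.
by rewrite -mul_mpolyC; apply: M.
Qed.

Lemma ideal_sub_congr I p q : is_ideal I -> I (p - q) -> I p <-> I q.
Proof.
move=> iI Ipq; split=> [Ip|Iq].
  by rewrite -[q](subKr p); apply: idealB.
by rewrite -[p](subrK q); apply: idealD.
Qed.

Lemma zero_homog_ideal : homog_ideal zero_ideal.
Proof.
split; last by move=> p d ->; rewrite /zero_ideal pihomog0.
by split=> // [x y -> -> | r x ->]; rewrite /zero_ideal ?addr0 ?mulr0.
Qed.

Lemma add_gen_ideal I x : is_ideal I -> is_ideal (add_gen I x).
Proof.
case=> I0 D M; split.
- by exists 0, 0; rewrite mul0r addr0.
- move=> _ _ [i [r [Ii ->]]] [j [q [Ij ->]]]; exists (i + j), (r + q).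
  by split; [apply: D | rewrite mulrDl addrACA].
- move=> c _ [i [r [Ii ->]]]; exists (c * i), (c * r).
  by split; [apply: M | rewrite mulrDr mulrA].
Qed.

Lemma sub_add_gen I x p : I p -> add_gen I x p.
Proof. by move=> Ip; exists p, 0; rewrite mul0r addr0. Qed.

Lemma mem_add_gen I x : is_ideal I -> add_gen I x x.
Proof. by case=> I0 _ _; exists 0, 1; rewrite mul1r add0r. Qed.

Lemma add_gen_min I J x : is_ideal J ->
  (forall p, I p -> J p) -> J x -> forall p, add_gen I x p -> J p.
Proof.
move=> iJ IJ Jx _ [i [r [/IJ Ji ->]]].
by apply: idealD => //; apply: idealMl.
Qed.

Lemma add_gens_ideal I s : is_ideal I -> is_ideal (add_gens I s).
Proof. by elim: s I => //= x s IH I iI; apply/IH/add_gen_ideal. Qed.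

Lemma sub_add_gens I s p : I p -> add_gens I s p.
Proof. by elim: s I => //= x s IH I Ip; apply/IH/sub_add_gen. Qed.

Lemma mem_add_gens I s x : is_ideal I -> x \in s -> add_gens I s x.
Proof.
elim: s I => //= y s IH I iI; rewrite inE; case/predU1P => [->|xs].
  by apply/sub_add_gens/mem_add_gen.
by apply: IH => //; apply: add_gen_ideal.
Qed.

Lemma add_gens_min I J s : is_ideal J ->
  (forall p, I p -> J p) -> (forall x, x \in s -> J x) ->
  forall p, add_gens I s p -> J p.
Proof.
move=> iJ; elim: s I => //= x s IH I IJ sJ; apply: IH.
  by apply: add_gen_min => //; apply: sJ; rewrite inE eqxx.
by move=> y ys; apply: sJ; rewrite inE ys orbT.
Qed.

Lemma add_gens_cat I s t : add_gens I (s ++ t) = add_gens (add_gens I s) t.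
Proof. exact: foldl_cat. Qed.

Lemma add_genC I x y : add_gen (add_gen I x) y = add_gen (add_gen I y) x.
Proof.
suff H a b p : add_gen (add_gen I a) b p -> add_gen (add_gen I b) a p.
  by apply: pred_ext => p; split; apply: H.
case=> _ [r [[i [q [Ii ->]]] ->]]; exists (i + r * b), q.
by split; [exists i, r | rewrite addrAC].
Qed.

Lemma add_gens_add_gen I s x : add_gens (add_gen I x) s = add_gen (add_gens I s) x.
Proof. by elim: s I => //= y s IH I; rewrite add_genC IH. Qed.

Lemma reg_cat I s t : reg I (s ++ t) <-> reg I s /\ reg (add_gens I s) t.
Proof. elim: s I => [|x s IH] I /=; first by tauto. by rewrite IH; tauto. Qed.

Lemma ideal_genP s p :
  ideal_gen s p <-> exists c : nat -> S, p = \sum_(i < size s) c i * s`_i.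
Proof.
split=> [[c ->]|[c ->]]; last by exists (fun i => c i).
exists (fun k => oapp c 0 (insub k)); apply: eq_bigr => i _.
by rewrite valK.
Qed.

Lemma ideal_gen_rcons s x : ideal_gen (rcons s x) = add_gen (ideal_gen s) x.
Proof.
apply: pred_ext => p; rewrite ideal_genP; split.
  case=> c; rewrite size_rcons big_ord_recr /= => ->.
  exists (\sum_(i < size s) c i * s`_i), (c (size s)).
  split; first by apply/ideal_genP; exists c.
  rewrite nth_rcons ltnn eqxx; congr (_ + _).
  by apply: eq_bigr => i _; rewrite nth_rcons ltn_ord.
case=> _ [r [/ideal_genP [c ->] ->]].
exists (fun k => if k == size s then r else c k).
rewrite size_rcons big_ord_recr /= eqxx nth_rcons ltnn eqxx; congr (_ + _).
by apply: eq_bigr => i _; rewrite ltn_eqF // nth_rcons ltn_ord.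
Qed.

Lemma ideal_gen_nil : ideal_gen [::] = zero_ideal.
Proof.
apply: pred_ext => p; rewrite ideal_genP; split; first by case=> c; rewrite big_ord0.
by move=> ->; exists (fun=> 0); rewrite big_ord0.
Qed.

Lemma ideal_genE s : ideal_gen s = add_gens zero_ideal s.
Proof.
elim/last_ind: s => [|s x IH]; first exact: ideal_gen_nil.
by rewrite ideal_gen_rcons IH -cats1 add_gens_cat.
Qed.

Lemma regular_seqP s :
  regular_seq s <-> ~ add_gens zero_ideal s 1 /\ reg zero_ideal s.
Proof.
rewrite /regular_seq ideal_genE.
suff H : (forall i, (i < size s)%N -> forall p, ideal_gen (take i s) (p * s`_i) ->
    ideal_gen (take i s) p) <-> reg zero_ideal s by rewrite H.
elim/last_ind: s => [|s x IH]; first by split.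
rewrite -cats1 reg_cat -IH /= -ideal_genE; split=> [H|[H1 [H2 _]] i].
  split=> [i lt|].
    have := H i; rewrite cats1 size_rcons => /(_ (ltnW lt)).
    by rewrite nth_rcons lt -cats1 take_cat lt.
  split=> // p; have := H (size s); rewrite size_cat addn1 => /(_ (ltnSn _) p).
  by rewrite take_size_cat // nth_cat ltnn subnn.
rewrite size_cat addn1 ltnS leq_eqVlt => /predU1P [->|lt] p.
  by rewrite take_size_cat // nth_cat ltnn subnn; apply: H2.
by rewrite take_cat lt nth_cat lt; apply: H1.
Qed.

Lemma pihomogM_homog p x d e : x \is d.-homog ->
  'pi_e (p * x) = if (d <= e)%N then 'pi_(e - d) p * x else 0.
Proof.
move=> hx; have -> := @pihomog_partitionE _ _ mdeg _ p (leqnn _).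
rewrite mulr_suml !linear_sum mulr_suml /=.
have H (k : nat) : 'pi_e ('pi_k p * x) =
    if (d <= e)%N then 'pi_(e - d) ('pi_k p) * x else 0.
  have hk := pihomogP mdeg k p.
  have hkx := dhomogM hk hx.
  have [E|ne] := eqVneq (k + d)%N e.
    by rewrite -E leq_addl addnK (pihomog_dE hkx) (pihomog_dE hk).
  rewrite (pihomog_ne0 ne hkx); case: leqP => // le.
  by rewrite (pihomog_ne0 _ hk) ?mul0r //; apply/eqP; move/eqP: ne; lia.
rewrite (eq_bigr _ (fun (i : 'I_(mmeasure mdeg p)) _ => H i)).
by case: leqP => // _; rewrite big1.
Qed.

Lemma pihomogMD p x d k : x \is d.-homog -> 'pi_(k + d) (p * x) = 'pi_k p * x.
Proof. by move=> hx; rewrite (pihomogM_homog _ _ hx) leq_addl addnK. Qed.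

Lemma ideal_of_pihomog I p : is_ideal I -> (forall d, I ('pi_d p)) -> I p.
Proof.
move=> iI H; rewrite (@pihomog_partitionE _ _ mdeg _ p (leqnn _)).
exact: ideal_sum.
Qed.

Lemma add_gen_homog I x d : x \is d.-homog -> homog_ideal I -> homog_ideal (add_gen I x).
Proof.
move=> hx [iI hI]; split; first exact: add_gen_ideal.
move=> _ e [i [r [Ii ->]]]; rewrite linearD /= (pihomogM_homog _ _ hx).
case: leqP => _; first by exists ('pi_e i), ('pi_(e - d) r); split=> //; apply: hI.
by rewrite addr0; apply/sub_add_gen/hI.
Qed.

Lemma colon_ideal I x : is_ideal I -> is_ideal (colon I x).
Proof.
case=> I0 D M; split; rewrite /colon; first by rewrite mul0r.
- by move=> p q Ip Iq; rewrite mulrDl; apply: D.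
- by move=> r p Ip; rewrite -mulrA; apply: M.
Qed.

Lemma colon_homog I x d : x \is d.-homog -> homog_ideal I -> homog_ideal (colon I x).
Proof.
move=> hx [iI hI]; split; first exact: colon_ideal.
by move=> p e Ip; rewrite /colon -(pihomogMD _ _ hx); apply: hI.
Qed.

Lemma nzd_homog I x d : x \is d.-homog -> homog_ideal I ->
  (forall k p, p \is k.-homog -> I (p * x) -> I p) -> nzd I x.
Proof.
move=> hx [iI hI] H p Ip; apply: ideal_of_pihomog => // k.
by apply: (H k); rewrite ?pihomogP // -(pihomogMD _ _ hx); apply: hI.
Qed.

(** If [p * y] is in [I], then [p] is [r * x] modulo [I], and [r * y] is in [I] because [x] is a
    nonzerodivisor. As [0 < d], the degree of [r] is smaller, so induction on the degree, a graded
    Nakayama argument, puts [r] in [I]. *)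
Lemma nzd_swap I x y d e : homog_ideal I -> x \is d.-homog -> y \is e.-homog ->
  (0 < d)%N -> nzd I x -> nzd (add_gen I x) y -> nzd I y /\ nzd (add_gen I y) x.
Proof.
move=> hI hx hy d0 Ix Ixy; have iI := hI.1; split.
  apply: (nzd_homog hy hI) => k; elim/ltn_ind: k => k IH p hp Ipy.
  have /Ixy [i [r [Ii E]]] : add_gen I x (p * y) by apply: sub_add_gen.
  have E2 : p = 'pi_k i + 'pi_k (r * x) by rewrite -linearD /= -E pihomog_dE.
  have Ii' : I ('pi_k i) by apply: hI.2.
  rewrite (pihomogM_homog _ _ hx) in E2; case: leqP E2 => dk E2; last first.
    by rewrite E2 addr0.
  rewrite E2; apply: idealD => //; apply: idealMr => //.
  apply: (IH (k - d)%N); [lia | exact: pihomogP |].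
  apply: Ix; rewrite mulrAC -[_ * x](addKr ('pi_k i)) -E2 mulrDl mulNr.
  rewrite addrC; apply: idealB => //; exact: idealMr.
move=> p [i [r [Ii E]]].
have /Ixy [j [q [Ij Er]]] : add_gen I x (r * y).
  exists (- i), p; split; first exact: idealN.
  by rewrite E addKr.
exists (p - q * y), q; split; last by rewrite subrK.
apply: Ix; rewrite mulrBl E mulrAC Er.
rewrite (_ : _ - _ = i + j * y); last by ring.
by apply: idealD => //; apply: idealMr.
Qed.

Definition homog_pos x := exists2 d, (0 < d)%N & x \is d.-homog.
Definition homog_seq s := forall x, x \in s -> homog_pos x.

Lemma add_gens_homog I s : homog_ideal I -> homog_seq s -> homog_ideal (add_gens I s).
Proof.
elim: s I => //= x s IH I hI hs; apply: IH => [|y ys]; last first.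
  by apply: hs; rewrite inE ys orbT.
by have [d _ hx] := hs x (mem_head _ _); exact: (add_gen_homog hx hI).
Qed.

Lemma reg_swap I x y s : homog_ideal I -> homog_pos x -> homog_pos y ->
  reg I [:: x, y & s] -> reg I [:: y, x & s].
Proof.
move=> hI [d d0 hx] [e _ hy] /= [Ix [Iy rs]].
have [H1 H2] := nzd_swap hI hx hy d0 Ix Iy.
by split=> //; split=> //; rewrite add_genC.
Qed.

Lemma reg_move I s x t : homog_ideal I -> homog_seq (s ++ x :: t) ->
  reg I (s ++ x :: t) <-> reg I (x :: s ++ t).
Proof.
elim: s I => [|y s IH] I hI hs; first by [].
have [hx hy] : homog_pos x /\ homog_pos y.
  by split; apply: hs; rewrite !(inE, mem_cat) eqxx ?orbT.
have E : reg I ((y :: s) ++ x :: t) <-> reg I [:: y, x & s ++ t].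
  have IHy : reg (add_gen I y) (s ++ x :: t) <-> reg (add_gen I y) (x :: s ++ t).
    apply: IH => [|z zs]; last by apply: hs; rewrite /= inE zs orbT.
    by case: hy => d _ hy; exact: (add_gen_homog hy hI).
  by split=> -[H1 H2]; split=> //; apply/IHy.
by rewrite E; split; apply: reg_swap.
Qed.

Lemma add_gens_perm I s t : perm_eq s t -> add_gens I s = add_gens I t.
Proof.
elim: t s I => [|x t IH] s I; first by move/perm_nilP ->.
move=> pst; have xs : x \in s by rewrite (perm_mem pst) mem_head.
case/splitPr: xs pst => s1 s2 pst.
have {}pst : perm_eq (s1 ++ s2) t.
  by rewrite -(perm_cons x) -(permPr pst) perm_sym; apply/permPl/(perm_catCA s1 [:: x] s2).
by rewrite add_gens_cat -[RHS]/(add_gens (add_gen I x) t) -(IH _ _ pst) add_gens_cat add_gens_add_gen.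
Qed.

Lemma reg_perm I s t : homog_ideal I -> homog_seq s -> perm_eq s t ->
  reg I s -> reg I t.
Proof.
elim: t s I => [|x t IH] s I hI hs; first by move/perm_nilP ->.
move=> pst; have xs : x \in s by rewrite (perm_mem pst) mem_head.
case/splitPr: xs pst hs => s1 s2 pst hs.
have {}pst : perm_eq (s1 ++ s2) t.
  by rewrite -(perm_cons x) -(permPr pst) perm_sym; apply/permPl/(perm_catCA s1 [:: x] s2).
move/(reg_move hI hs) => /= [Ix rs]; split=> //.
apply: (IH _ _ _ _ pst rs).
  have [d _ hx] : homog_pos x by apply: hs; rewrite mem_cat inE eqxx orbT.
  exact: (add_gen_homog hx hI).
by move=> y ys; apply: hs; rewrite mem_cat inE orbCA -mem_cat ys orbT.
Qed.

End Ideals.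

(** * Hilbert functions of ideals *)

(** On generating series this is multiplication by [1/(1-t)]; it undoes the effect on Hilbert
    functions of dividing by a linear nonzerodivisor. *)
Definition sumop (u : nat -> nat) (j : nat) : nat := (\sum_(i < j.+1) u i)%N.

Lemma iter_sumop_le k u v : (forall j, (u j <= v j)%N) ->
  forall j, (iter k sumop u j <= iter k sumop v j)%N.
Proof. by move=> uv; elim: k => //= k IH j; apply: leq_sum => i _; apply: IH. Qed.

Lemma sumopS u j : sumop u j.+1 = (sumop u j + u j.+1)%N.
Proof. by rewrite /sumop big_ord_recr. Qed.

Definition homog_degs (K : fieldType) n (s : seq {mpoly K[n]}) (d : seq nat) :=
  size s = size d /\ forall i, (i < size s)%N -> s`_i \is (nth 0%N d i).-homog.

Lemma homog_degs_cons (K : fieldType) n x (s : seq {mpoly K[n]}) e d :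
  homog_degs (x :: s) (e :: d) <-> x \is e.-homog /\ homog_degs s d.
Proof.
split=> [[[sz] H]|[hx [sz H]]].
  by split; [apply: (H 0%N) | split=> // i lt; apply: (H i.+1)].
by split=> [/=|[|i] //= lt]; [rewrite sz | apply: H].
Qed.

Section IdealHilbertFunction.
Variable (K : fieldType).

Lemma HF_preim n m (I : {mpoly K[m]} -> Prop)
    (F : {linear {mpoly K[n]} -> {mpoly K[m]}}) (d : nat) :
  lin_closed I -> (forall p, p \is d.-homog -> F p \is d.-homog) ->
  (forall q, q \is d.-homog -> exists2 p, p \is d.-homog & I (q - F p)) ->
  HF (fun p => I (F p)) d = HF I d.
Proof.
move=> lI hF sF; have [I0 IL] := lI.
rewrite -(HF_rank_nullity lI hF) [X in (_ + X)%N]HF_full ?addn0 //.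
split.
  by exists 0; rewrite ?rpred0 // linear0 subrr.
move=> c x y [p hp Ip] [q hq Iq]; exists (c *: p + q).
  by apply: rpredD => //; apply: rpredZ.
rewrite linearP (_ : _ - _ = c *: (x - F p) + (y - F q)); first exact: IL.
by rewrite scalerBr opprD addrACA.
Qed.

Variable (n : nat).
Implicit Types (I J : {mpoly K[n]} -> Prop) (d e j : nat) (x : {mpoly K[n]}).

Lemma HF_ideal_mono I J j : is_ideal I -> is_ideal J ->
  (forall p, I p -> J p) -> (HF J j <= HF I j)%N.
Proof. by move=> iI iJ H; apply: HF_mono => [||p _ /H] //; apply: ideal_lin. Qed.

(** Dimension count in the exact sequence [0 -> S/(I : x)(-d) -> S/I -> S/(I + (x)) -> 0]. *)
Lemma HF_colon_add_gen I x d j : homog_ideal I -> x \is d.-homog ->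
  (HF (colon I x) j + HF (add_gen I x) (j + d)%N = HF I (j + d)%N)%N.
Proof.
move=> [iI hI] hx; pose F p := p * x.
have Flin : linear F by move=> c p q; rewrite /F mulrDl scalerAl.
pose FL := GRing.isLinear.Build K _ _ _ F Flin.
pose Fl : {linear {mpoly K[n]} -> {mpoly K[n]}} := HB.pack F FL.
have lI := ideal_lin iI.
rewrite -(@HF_rank_nullity _ _ _ I Fl j (j + d)%N lI) => [|p hp]; last exact: dhomogM.
congr (_ + _)%N; apply: HF_eq.
- exact/ideal_lin/add_gen_ideal.
- split; first by exists 0; rewrite ?rpred0 // linear0 subrr; case: lI.
  move=> c a b [p hp Ip] [q hq Iq]; exists (c *: p + q).
    by apply: rpredD => //; apply: rpredZ.
  rewrite linearP (_ : _ - _ = c *: (a - Fl p) + (b - Fl q)); first exact: lI.2.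
  by rewrite scalerBr opprD addrACA.
move=> q hq; split=> [[i [r [Ii E]]]|[p hp Ip]]; last first.
  by exists (q - Fl p), p; rewrite subrK.
exists ('pi_j r); first exact: pihomogP.
rewrite /= /F -(pihomogMD _ _ hx) -(pihomog_dE hq) E -linearB /= addrK.
exact: hI.
Qed.

Lemma HF_add_gen_low I x d e : homog_ideal I -> x \is d.-homog -> (e < d)%N ->
  HF (add_gen I x) e = HF I e.
Proof.
move=> [iI hI] hx lt; apply: HF_eq; try exact: ideal_lin.
  exact/ideal_lin/add_gen_ideal.
move=> p hp; split=> [[i [r [Ii E]]]|]; last exact: sub_add_gen.
rewrite -(pihomog_dE hp) E linearD /= (pihomogM_homog _ _ hx) leqNgt lt addr0.
exact: hI.
Qed.

Lemma colon_nzd I x : is_ideal I -> nzd I x -> colon I x = I.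
Proof. by move=> iI H; apply: pred_ext => p; split=> [/H|] //; apply: idealMr. Qed.

Lemma HF_nzd I x d j : homog_ideal I -> x \is d.-homog -> nzd I x ->
  (HF I j + HF (add_gen I x) (j + d)%N = HF I (j + d)%N)%N.
Proof.
move=> hI hx Ix.
by rewrite -{1}(colon_nzd hI.1 Ix) HF_colon_add_gen.
Qed.

(** The colon by [x] contains [I], so the increment of the Hilbert function from [j] to [j + 1] is
    at most the value of the quotient at [j + 1]. *)
Lemma HF_linear_form_le I x : homog_ideal I -> x \is 1.-homog ->
  forall j, (HF I j <= sumop (fun j => HF (add_gen I x) j) j)%N.
Proof.
move=> hI hx; elim=> [|j IH].
  by rewrite /sumop big_ord1 (HF_add_gen_low hI hx).
rewrite sumopS; have := HF_colon_add_gen j hI hx; rewrite addn1.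
have : (HF (colon I x) j <= HF I j)%N.
  apply: HF_ideal_mono; [exact: hI.1 | exact: (colon_ideal x hI.1) | move=> p].
  exact: (idealMr _ hI.1).
lia.
Qed.

Lemma HF_linear_form_eq I x : homog_ideal I -> x \is 1.-homog -> nzd I x ->
  forall j, HF I j = sumop (fun j => HF (add_gen I x) j) j.
Proof.
move=> hI hx Ix; elim=> [|j IH].
  by rewrite /sumop big_ord1 (HF_add_gen_low hI hx).
by rewrite sumopS -IH -[j.+1]addn1 HF_nzd.
Qed.

Lemma HF_linear_forms_le I (ls : seq {mpoly K[n]}) : homog_ideal I ->
  (forall l, l \in ls -> l \is 1.-homog) ->
  forall j, (HF I j <= iter (size ls) sumop (fun j => HF (add_gens I ls) j) j)%N.
Proof.
elim: ls I => //= l ls IH I hI hls j.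
have hl : l \is 1.-homog by apply: hls; rewrite mem_head.
apply: leq_trans (HF_linear_form_le hI hl j) _.
apply: leq_sum => i _; apply: IH; first exact: (add_gen_homog hl hI).
by move=> y ys; apply: hls; rewrite inE ys orbT.
Qed.

Lemma HF_linear_forms_eq I (ls : seq {mpoly K[n]}) : homog_ideal I ->
  (forall l, l \in ls -> l \is 1.-homog) -> reg I ls ->
  forall j, HF I j = iter (size ls) sumop (fun j => HF (add_gens I ls) j) j.
Proof.
elim: ls I => //= l ls IH I hI hls [Il rls] j.
have hl : l \is 1.-homog by apply: hls; rewrite mem_head.
rewrite (HF_linear_form_eq hI hl Il j).
apply: eq_bigr => i _; apply: IH => //; first exact: (add_gen_homog hl hI).
by move=> y ys; apply: hls; rewrite inE ys orbT.
Qed.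

End IdealHilbertFunction.

(** A nonzerodivisor of degree [e] changes the Hilbert function by a rule that involves [e] alone.
    This allows [fs] to be compared with the extension of a quite different sequence [fb]. *)
Lemma HF_reg_degs (K : fieldType) n m (I : {mpoly K[n]} -> Prop)
    (J : {mpoly K[m]} -> Prop) fs gs d :
  homog_ideal I -> homog_ideal J -> homog_degs fs d -> homog_degs gs d ->
  reg I fs -> reg J gs -> (forall j : nat, HF I j = HF J j) ->
  forall j : nat, HF (add_gens I fs) j = HF (add_gens J gs) j.
Proof.
elim: d fs gs I J => [|e d IH] [|f fs] [|g gs] I J hI hJ hfs hgs;
  try by [|case: hfs => [] // | case: hgs => []].
move/homog_degs_cons: hfs hgs => [hf hfs] /homog_degs_cons [hg hgs].
move=> /= [If rf] [Jg rg] E; apply: IH => //.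
- exact: (add_gen_homog hf hI).
- exact: (add_gen_homog hg hJ).
move=> j; case: (ltnP j e) => [lt|le].
  by rewrite (HF_add_gen_low hI hf) // (HF_add_gen_low hJ hg) // E.
rewrite -(subnK le).
have := HF_nzd (j - e) hI hf If; have := HF_nzd (j - e) hJ hg Jg.
by rewrite !E => <- /addnI.
Qed.

(** * Substitutions *)

Lemma mpoly_rmorph_eq (R : pzRingType) (K : fieldType) n
    (f g : {rmorphism {mpoly K[n]} -> R}) :
  (forall c, f c%:MP = g c%:MP) -> (forall i, f 'X_i = g 'X_i) -> f =1 g.
Proof.
move=> fgC fgX p; rewrite (mpolyE p) !rmorph_sum /=; apply: eq_bigr => m _.
rewrite -mul_mpolyC !rmorphM fgC; congr (_ * _).
rewrite mpolyXE_id !rmorph_prod; apply: eq_bigr => i _.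
by rewrite !rmorphXn /= fgX.
Qed.

Section Substitution.
Variable K : fieldType.

Lemma comp_mpoly_homog n m (lq : n.-tuple {mpoly K[m]}) p d :
  (forall i, tnth lq i \is 1.-homog) -> p \is d.-homog -> p \mPo lq \is d.-homog.
Proof.
move=> hl /dhomogP hp; rewrite comp_mpolyE big_seq; apply: rpred_sum => mm mp.
apply: rpredZ; have <- : mdeg mm = d := hp _ mp; rewrite mdegE.
elim/big_rec2: _ => [|i a b _ hb]; first exact: dhomog1.
by apply: dhomogM => //; have := dhomogMn (mm i) (hl i); rewrite mul1n.
Qed.

Lemma comp_mpoly_congr n m (J : {mpoly K[m]} -> Prop) (l1 l2 : n.-tuple {mpoly K[m]}) p :
  is_ideal J -> (forall i, J (tnth l1 i - tnth l2 i)) -> J ((p \mPo l1) - (p \mPo l2)).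
Proof.
move=> iJ H; rewrite !comp_mpolyE -sumrB; apply: ideal_sum => // mm _.
rewrite -scalerBr -mul_mpolyC; apply: idealMl => //.
have JM a b c e : J (a - b) -> J (c - e) -> J (a * c - b * e).
  move=> Jab Jce; rewrite (_ : _ - _ = c * (a - b) + b * (c - e)); last by ring.
  by apply: idealD => //; apply: idealMl.
have J0 : J (1 - 1) by rewrite subrr; case: iJ.
elim/big_rec2: _ => // i a b _ Jab; apply: (JM) => //.
by elim: (mm i) => // k IH; rewrite !exprS; apply: JM.
Qed.

Lemma comp_mpoly_scale n m (a : 'I_n -> K) (l : {mpoly K[m]}) p d : p \is d.-homog ->
  p \mPo [tuple a i *: l | i < n] = p.@[a] *: l ^+ d.
Proof.
move=> /dhomogP hp; rewrite comp_mpolyE mevalE scaler_suml big_seq [RHS]big_seq.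
apply: eq_bigr => mm mp; have <- : mdeg mm = d := hp _ mp; rewrite -scalerA mdegE; congr (_ *: _).
rewrite -prodrXr -scaler_prod; apply: eq_bigr => i _.
by rewrite tnth_mktuple exprZn.
Qed.

Variable n : nat.
Local Notation S := {mpoly K[n]}.

(** The coefficients stay in [S], so variables can be singled out one after another without a change
    of ring. That ['X_k] is absent from them is [free_uni_coef]. *)
Definition uni (k : 'I_n) : S -> {poly S} :=
  mmap (polyC \o @mpolyC n K) (fun i => if i == k then 'X else ('X_i)%:P).
HB.instance Definition _ k := GRing.RMorphism.copy (uni k)
  (mmap (polyC \o @mpolyC n K) (fun i => if i == k then 'X else ('X_i)%:P)).

Lemma uniC k c : uni k c%:MP = (c%:MP)%:P.
Proof. by rewrite /uni mmapC. Qed.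

Lemma uniX k i : uni k 'X_i = if i == k then 'X else ('X_i)%:P.
Proof. by rewrite /uni mmapX mmap1U. Qed.

Lemma horner_uni k (x : S) p :
  (uni k p).[x] = p \mPo [tuple if i == k then x else 'X_i | i < n].
Proof.
have := @mpoly_rmorph_eq _ _ _ (horner_eval x \o uni k)
  (comp_mpoly [tuple if i == k then x else 'X_i | i < n]).
apply=> [c|i] /=; first by rewrite uniC horner_evalE hornerC comp_mpolyC.
rewrite uniX comp_mpolyXU -tnth_nth tnth_mktuple horner_evalE.
by case: ifP => _; rewrite ?hornerX ?hornerC.
Qed.

Lemma horner_uniX k p : (uni k p).['X_k] = p.
Proof.
rewrite horner_uni -[RHS]comp_mpoly_id; congr (_ \mPo _).
by apply: eq_from_tnth => i; rewrite !tnth_mktuple; case: eqP => // ->.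
Qed.

Lemma uni_inj k : injective (uni k).
Proof. by move=> p q E; rewrite -(horner_uniX k p) E horner_uniX. Qed.

Lemma poly_nonroot (K_infinite : forall s : seq K, exists x, x \notin s) (q : {poly S}) :
  q != 0 -> exists c : K, q.[c%:MP] != 0.
Proof.
move=> q0; apply: NNPP => N.
have H c : root q c%:MP by apply/rootP/eqP; apply: contra_notT N => H; exists c.
have inj : injective (@mpolyC n K) by move=> a b /eqP; rewrite mpolyC_eq => /eqP.
have [s [us ss]] : exists s : seq K, uniq s /\ size s = size q.
  elim: (size q) => [|k [s [us ss]]]; first by exists [::].
  by have [x xs] := K_infinite s; exists (x :: s); rewrite /= xs us ss.
have := @max_poly_roots _ q (map (@mpolyC n K) s) q0.
rewrite map_inj_uniq // us size_map ss ltnn => /(_ _ isT) F.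
by have /F : all (root q) (map (@mpolyC n K) s) by apply/allP => _ /mapP [c _ ->].
Qed.

Lemma meval_nonzero (K_infinite : forall s : seq K, exists x, x \notin s) (p : S) :
  p != 0 -> exists a : 'I_n -> K, p.@[a] != 0.
Proof.
move=> p0.
(* The list [s] holds the variables already replaced by constants; one more variable is specialized
   at each step, by [poly_nonroot]. *)
suff H (s : seq 'I_n) : exists a : 'I_n -> K,
    p \mPo [tuple if i \in s then (a i)%:MP else 'X_i | i < n] != 0.
  have [a Ha] := H (enum 'I_n); exists a; apply: contraNneq Ha => E.
  have := @mpoly_rmorph_eq _ _ _ (@mpolyC n K \o meval a)
    (comp_mpoly [tuple if i \in enum 'I_n then (a i)%:MP else 'X_i | i < n]).
  move=> <-; [by rewrite /= E mpolyC0 | move=> c | move=> i] => /=.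
    by rewrite mevalC comp_mpolyC.
  by rewrite mevalXU comp_mpolyXU -tnth_nth tnth_mktuple mem_enum.
elim: s => [|k s [a Ha]].
  by exists (fun=> 0); rewrite (_ : [tuple _ | _ < n] = [tuple 'X_i | i < n]) ?comp_mpoly_id.
have : uni k (p \mPo [tuple if i \in s then (a i)%:MP else 'X_i | i < n]) != 0.
  by rewrite -[0](raddf0 (uni k)) (inj_eq (@uni_inj k)).
case/(poly_nonroot K_infinite) => c Hc.
(* If [k] is already in [s], its variable has been replaced before and keeps the old value. *)
exists (fun i => if (i == k) && (k \notin s) then c else a i).
apply: contraNneq Hc => E; apply/eqP; rewrite horner_uni -[RHS]E.
have := @mpoly_rmorph_eq _ _ _
  (comp_mpoly [tuple if i == k then c%:MP_[n] else 'X_i | i < n] \o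
   comp_mpoly [tuple if i \in s then (a i)%:MP_[n] else 'X_i | i < n])
  (comp_mpoly [tuple if i \in k :: s then
    (if (i == k) && (k \notin s) then c else a i)%:MP_[n] else 'X_i | i < n]).
move=> <-; [by [] | move=> e | move=> i] => /=; first by rewrite !comp_mpolyC.
rewrite !comp_mpolyXU -!tnth_nth !tnth_mktuple inE.
case: (boolP (i \in s)) => [is_|nis].
  rewrite orbT comp_mpolyC; case: eqP => [E2|] //=.
  by rewrite -E2 is_.
rewrite orbF comp_mpolyXU -tnth_nth tnth_mktuple; case: eqP => // E2.
by rewrite -E2 nis.
Qed.

Definition vars (s : seq 'I_n) : seq S := [seq 'X_i | i <- s].

Lemma add_gens_varsP (s : seq 'I_n) (p : S) :
  add_gens (@zero_ideal K n) (vars s) p <->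
  p \mPo [tuple if i \in s then 0 else 'X_i | i < n] = 0.
Proof.
set lq := [tuple _ | _ < n]; split.
  pose J (q : S) := q \mPo lq = 0.
  have iJ : is_ideal J.
    split; rewrite /J; first exact: comp_mpoly0.
      by move=> x y Ex Ey; rewrite comp_mpolyD Ex Ey addr0.
    by move=> r x Ex; rewrite rmorphM /= Ex mulr0.
  apply: (add_gens_min iJ) => [q ->|_ /mapP [i is_ ->]]; rewrite /J ?comp_mpoly0 //.
  by rewrite comp_mpolyXU -tnth_nth tnth_mktuple is_.
move=> E; rewrite -(comp_mpoly_id p) -[_ \mPo _]subr0 -E.
have i0 := (@zero_homog_ideal K n).1.
apply: comp_mpoly_congr; first exact: add_gens_ideal.
move=> i; rewrite !tnth_mktuple; case: ifP => is_; last first.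
  by rewrite subrr; case: (add_gens_ideal (vars s) i0).
by rewrite subr0; apply: mem_add_gens => //; apply: map_f.
Qed.

Lemma reg_vars (s t : seq 'I_n) : uniq (s ++ t) ->
  reg (add_gens (@zero_ideal K n) (vars s)) (vars t).
Proof.
elim: t s => //= i t IH s ust; have ins : i \notin s.
  by move: ust; rewrite cat_uniq /= negb_or; case/and3P => _ /andP [].
split; last first.
  have := IH (rcons s i); rewrite cat_rcons => /(_ ust).
  by rewrite /vars map_rcons -cats1 add_gens_cat.
move=> p /add_gens_varsP; rewrite rmorphM /= comp_mpolyXU -tnth_nth tnth_mktuple.
rewrite (negbTE ins) => /eqP; rewrite mulf_eq0 => /orP [/eqP E|].
  exact/add_gens_varsP.
by rewrite -msize_poly_eq0 msizeX.
Qed.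

Lemma homog1E (l : S) : l \is 1.-homog -> l = \sum_i l@_U_(i) *: 'X_i.
Proof.
move=> hl; apply/mpolyP => m; rewrite raddf_sum /=.
case: (boolP (mdeg m == 1%N)) => [/mdeg1P [i /eqP ->]|nm]; last first.
  rewrite (dhomog_nemf_coeff hl nm) big1 // => i _; rewrite mcoeffZ mcoeffX.
  by case: eqP => [E|]; rewrite ?mulr0 //; rewrite -E mdeg1 in nm.
rewrite (bigD1 i) //= mcoeffZ mcoeffX eqxx mulr1 big1 ?addr0 // => j ne.
by rewrite mcoeffZ mcoeffX eq_mnm1 (negbTE ne) mulr0.
Qed.

End Substitution.

(** * Socles *)

Lemma sumop_const u a : (forall j, (a < j)%N -> u j = 0%N) ->
  forall j, (a <= j)%N -> sumop u j = sumop u a.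
Proof.
move=> u0 j le; rewrite -(subnKC le); elim: (j - a)%N => [|k IH]; first by rewrite addn0.
by rewrite addnS sumopS IH u0 ?addn0 // ltnS leq_addr.
Qed.

Lemma sumop_mono u : {homo sumop u : i j / (i <= j)%N}.
Proof.
move=> i j le; rewrite -(subnKC le); elim: (j - i)%N => [|k IH]; first by rewrite addn0.
by rewrite addnS sumopS; apply: leq_trans IH (leq_addr _ _).
Qed.

Lemma sumop_le_const u a : (forall j, (a < j)%N -> u j = 0%N) ->
  forall j, (sumop u j <= sumop u a)%N.
Proof.
move=> u0 j; case: (leqP a j) => [le|/ltnW le]; first by rewrite (sumop_const u0).
exact: sumop_mono.
Qed.

Lemma iter_sumop_bound u c k : (forall j, (u j <= c)%N) ->
  forall j, (iter k sumop u j <= c * j.+1 ^ k)%N.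
Proof.
move=> uc; elim: k => [|k IH] j; first by rewrite expn0 muln1.
have : (iter k.+1 sumop u j <= \sum_(i < j.+1) c * j.+1 ^ k)%N.
  rewrite /= /sumop; apply: leq_sum => i _; apply: leq_trans (IH i) _.
  by rewrite leq_mul2l; apply/orP; right; case: (k) => // k'; rewrite leq_exp2r // ltn_ord.
by rewrite sum_nat_const card_ord expnS; lia.
Qed.

Lemma expn_le_bin N k : (N.+1 ^ k <= 'C(N + k, k) * k`!)%N.
Proof.
rewrite bin_ffact; elim: k => [|k IH]; first by rewrite ffactn0.
by rewrite addnS ffactnS expnS; apply: leq_mul => //; lia.
Qed.

(** For [0 < k], the [k]-fold sum of a finitely supported function is [O(N^(k-1))], hence so is the
    increment of the [(k+1)]-fold sum over [e] steps, while the binomial has order [N^k]. For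
    [k = 0] the sum is eventually constant and the binomial is 1. *)
Lemma growth_gap u a k e : (0 < e)%N -> (forall j, (a < j)%N -> u j = 0%N) ->
  exists2 N, (e <= N)%N &
    (iter k.+1 sumop u N < iter k.+1 sumop u (N - e) + 'C(N + k, k))%N.
Proof.
move=> e0 u0; case: k => [|k].
  exists (a + e)%N; first exact: leq_addl.
  by rewrite /= bin0 addn1 ltnS addnK (sumop_const u0) // leq_addr.
pose c := sumop u a; pose w := iter k.+1 sumop u.
have wb j : (w j <= c * j.+1 ^ k)%N.
  by rewrite /w iterSr; apply/iter_sumop_bound/sumop_le_const.
pose N := (e * c * k.+1`! + e)%N; exists N; first exact: leq_addl.
have step M : (forall j, (j <= N)%N -> (w j <= M)%N) ->
    forall i, (i <= e)%N -> (sumop w (N - e + i) <= sumop w (N - e) + i * M)%N.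
  move=> H; elim=> [|i IH] le; first by rewrite addn0 leq_addr.
  rewrite addnS sumopS mulSn; have := IH (ltnW le).
  have := H (N - e + i).+1; rewrite /N; lia.
have {}step := step (c * N.+1 ^ k)%N _ e (leqnn _).
have /step : forall j, (j <= N)%N -> (w j <= c * N.+1 ^ k)%N.
  move=> j le; apply: leq_trans (wb j) _.
  by rewrite leq_mul2l; apply/orP; right; case: (k) => // k'; rewrite leq_exp2r.
rewrite subnK ?leq_addl // -/(iter k.+2 sumop u) => H.
apply: leq_ltn_trans H _; rewrite ltn_add2l.
rewrite -(ltn_pmul2r (fact_gt0 k.+1)).
apply: leq_trans (expn_le_bin N k.+1).
rewrite expnS (_ : _ * _ * _ = e * c * k.+1`! * N.+1 ^ k)%N; last by ring.
by rewrite ltn_pmul2r ?expn_gt0 // /N; lia.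
Qed.

Section LinearParameters.
Variable K : fieldType.
Variable n : nat.
Local Notation S := {mpoly K[n]}.
Local Notation Z := (@zero_ideal K n).
Implicit Types (I J : S -> Prop) (ls fs s t : seq S).

(** Records the degree of the socle and not its dimension: a form outside [J] can be killed by all
    variables in degree [a] alone. *)
Definition socle_in_degree J (a : nat) := forall (s : S) e, s \is e.-homog -> ~ J s ->
  (forall i, J ('X_i * s)) -> e = a.

Lemma HF_zero_ideal m (d : nat) : HF (@zero_ideal K m) d = size (monos m d).
Proof.
have [U UI <-] := HF_subspace d (ideal_lin (@zero_homog_ideal K m).1).
rewrite (_ : U = 0%VS) ?dimv0 ?addn0 //; apply/eqP; rewrite -subv0.
apply/subvP => v /UI E; rewrite memv0 -(of_coefsK v) E linear0 //.
Qed.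

Lemma add_gens_proper s : homog_seq s -> ~ add_gens Z s 1.
Proof.
move=> hs; pose J (q : S) := q.@[fun=> 0] = 0.
have iJ : is_ideal J.
  split; rewrite /J; first exact: meval0.
    by move=> x y Ex Ey; rewrite mevalD Ex Ey addr0.
  by move=> r x Ex; rewrite mevalM Ex mulr0.
have J1 : ~ J 1 by rewrite /J meval1 => /eqP; rewrite oner_eq0.
move=> H; apply: J1; apply: (add_gens_min iJ _ _ H) => [q ->|x /hs [d d0 hx]].
  exact: meval0.
rewrite /J mevalE big_seq big1 // => m mx.
have Em : mdeg m = d := dhomog_mf hx mx.
have m0 : m != 0%MM by rewrite -mdeg_eq0 Em -lt0n.
have [i mi] : exists i, m i != 0%N.
  apply: NNPP => N; case/eqP: m0; apply/mnmP => i; rewrite mnm0E.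
  by apply/eqP; apply: contra_notT N => mi; exists i.
by rewrite (bigD1 i) //= expr0n (negbTE mi) mul0r mulr0.
Qed.

Lemma nzd_exp I x k : nzd I x -> nzd I (x ^+ k).
Proof.
move=> Ix; elim: k => [|k IH] p; first by rewrite expr0 mulr1.
by rewrite exprSr mulrA => /Ix /IH.
Qed.

Lemma add_gen_congr I x y : is_ideal I -> I (x - y) -> add_gen I x = add_gen I y.
Proof.
move=> iI Ixy.
suff H a b p : I (a - b) -> add_gen I a p -> add_gen I b p.
  apply: pred_ext => p; split; apply: H => //.
  by rewrite -opprB; apply: idealN.
move=> Iab [i [r [Ii ->]]]; exists (i + r * (a - b)), r; split; last by ring.
by apply: idealD => //; apply: idealMl.
Qed.

Lemma nzd_congr I x y : is_ideal I -> I (x - y) -> nzd I x -> nzd I y.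
Proof.
move=> iI Ixy H p Ipy; apply: H; rewrite -[x](subrK y) mulrDr.
by apply: idealD => //; apply: idealMl.
Qed.

Lemma reg_congr (T : Type) (r : seq T) (u v : T -> S) I : is_ideal I ->
  (forall i, I (u i - v i)) ->
  add_gens I (map u r) = add_gens I (map v r) /\
  (reg I (map u r) -> reg I (map v r)).
Proof.
elim: r I => //= i r IH I iI Iuv.
have iI' := add_gen_ideal (v i) iI.
have [|H1 H2] := IH _ iI'; first by move=> j; apply/sub_add_gen/Iuv.
rewrite (add_gen_congr iI (Iuv i)); split=> // -[Iu /H2 rr].
by split=> //; apply: nzd_congr (Iuv i) Iu.
Qed.

Lemma add_gen_scale I x c : c != 0 -> add_gen I (c *: x) = add_gen I x.
Proof.
move=> c0; apply: pred_ext => p; split=> -[i [r [Ii ->]]].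
  by exists i, (c *: r); rewrite -scalerAl scalerAr.
exists i, (c^-1 *: r); split=> //.
by rewrite -scalerAl -scalerAr scalerA mulVf // scale1r.
Qed.

Lemma nzd_scale I x c : is_ideal I -> c != 0 -> nzd I x -> nzd I (c *: x).
Proof.
move=> iI c0 H p; rewrite -scalerAr -mul_mpolyC => Ip; apply: H.
rewrite -[_ * x]scale1r -(mulVf c0) -scalerA -mul_mpolyC.
by apply: idealMl => //; rewrite -mul_mpolyC.
Qed.

(** Whatever [g] kills modulo [I] is killed by the power of [l]. The relation found by counting is
    turned into regularity of [g] this way. *)
Lemma nzd_of_power I g l r N : is_ideal I -> I (l ^+ N - r * g) -> nzd I l -> nzd I g.
Proof.
move=> iI E H p Ipg; apply: (nzd_exp (k := N) H).
rewrite -[l ^+ N](subrK (r * g)) mulrDr; apply: idealD => //.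
  exact: idealMl.
by rewrite mulrCA; apply: idealMl.
Qed.

(* If [l s = t g] modulo [I] then [t] spans a socle element modulo [I + (l)]
   whenever [s] does modulo [I + (g)]. *)
Lemma socle_exchange I g l e a : homog_ideal I -> g \is e.-homog -> (0 < e)%N ->
  l \is 1.-homog -> nzd I g -> nzd I l ->
  socle_in_degree (add_gen I l) a -> socle_in_degree (add_gen I g) (a + e).-1.
Proof.
move=> hI hg e0 hl Ig Il soc s k hs nIs socs; have iI := hI.1.
have iIg := add_gen_ideal g iI.
have : add_gen I g (l * s).
  rewrite (homog1E hl) mulr_suml; apply: ideal_sum => // i _.
  by rewrite -scalerAl -mul_mpolyC; apply: idealMl.
have hls := dhomogM hl hs; rewrite add1n in hls.
case=> i [t [Ii E]].
have {}E : l * s = 'pi_k.+1 i + 'pi_k.+1 (t * g) by rewrite -linearD /= -E pihomog_dE.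
have {}Ii : I ('pi_k.+1 i) by apply: hI.2.
(* In degree [k + 1 < e] a multiple of [g] has no component, so [l * s], and then [s], would lie in
   [I]. *)
rewrite (pihomogM_homog _ _ hg) in E; case: leqP E => ek E; last first.
  case: nIs; apply: sub_add_gen; apply: Il.
  by rewrite mulrC E addr0.
move: {i} ('pi_k.+1 i) E Ii => i E Ii.
have ht := pihomogP mdeg (k.+1 - e) t; move: {t} ('pi_(k.+1 - e) t) ht E => t ht E.
have <- : (k.+1 - e)%N = a; last by lia.
apply: (soc t) => //.
- case=> b [q [Ib Et]]; case: nIs; exists (s - q * g), q; split; last by rewrite subrK.
  apply: Il; rewrite mulrBl [s * l]mulrC E Et.
  rewrite (_ : _ - _ = i + b * g); last by ring.
  by apply: idealD => //; apply: idealMr.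
- move=> j; have [b [q [Ib Eb]]] := socs j.
  exists ('X_j * t - q * l), q; split; last by rewrite subrK.
  apply: Ig.
  have -> : ('X_j * t - q * l) * g = l * b - 'X_j * i.
    have H1 : 'X_j * (l * s) = l * (b + q * g) by rewrite -Eb; ring.
    have H2 : 'X_j * (t * g) = 'X_j * (l * s) - 'X_j * i by rewrite E; ring.
    by rewrite mulrBl -mulrA H2 H1; ring.
  by apply: idealB => //; apply: idealMl.
Qed.

End LinearParameters.

(** * Linear systems of parameters *)

Lemma homog_degs_rcons (K : fieldType) n x (s : seq {mpoly K[n]}) e d :
  homog_degs (rcons s x) (rcons d e) -> x \is e.-homog /\ homog_degs s d.
Proof.
case; rewrite !size_rcons => -[sz] H; split.
  by have := H (size s) (ltnSn _); rewrite sz !nth_rcons sz ltnn eqxx.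
split=> // i lt; have := H i (ltnW lt).
by rewrite !nth_rcons -sz lt.
Qed.

Lemma homog_degs_seq (K : fieldType) n (s : seq {mpoly K[n]}) d :
  homog_degs s d -> all (leq 1) d -> homog_seq s.
Proof.
elim: s d => [|x s IH] [|e d]; [by [] | by case | by case |].
case/homog_degs_cons => hx hs /= /andP [e0 d0] y; rewrite inE.
by case/predU1P => [->|]; [exists e | apply: IH hs d0 y].
Qed.

Section NoetherPosition.
Variable K : fieldType.
Hypothesis K_infinite : forall s : seq K, exists x : K, x \notin s.
Variable n : nat.
Local Notation S := {mpoly K[n]}.
Local Notation Z := (@zero_ideal K n).
Implicit Types (I J : S -> Prop) (ls fs s t : seq S).

Lemma linear_homog_seq ls : (forall l, l \in ls -> l \is 1.-homog) -> homog_seq ls.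
Proof. by move=> H x /H hx; exists 1%N. Qed.

Lemma homog_seq_cat s t : homog_seq s -> homog_seq t -> homog_seq (s ++ t).
Proof. by move=> hs ht x; rewrite mem_cat => /orP [/hs|/ht]. Qed.

(* Counting dimensions, some form [D] in [k+1] variables satisfies [D(ls) \in I + (g)];
   after a linear change of the [ls], [D] becomes monic in the first one. *)
Lemma exchange_parameter I g e l0 lt a : homog_ideal I -> g \is e.-homog -> (0 < e)%N ->
  nzd I g -> (forall l, l \in l0 :: lt -> l \is 1.-homog) -> reg I (l0 :: lt) ->
  (forall j, (a < j)%N -> HF (add_gens I (l0 :: lt)) (Posz j) = 0%N) ->
  exists l ls, [/\ size ls = size lt, (forall l', l' \in l :: ls -> l' \is 1.-homog),
    reg I (l :: ls), add_gens I (l :: ls) = add_gens I (l0 :: lt)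
    & nzd (add_gens I ls) g].
Proof.
move=> hI hg e0 Ig hls rls fin; have iI := hI.1; set k := size lt.
have [N eN gap] := @growth_gap (fun j => HF (add_gens I (l0 :: lt)) (Posz j)) a k e e0 fin.
rewrite -!(HF_linear_forms_eq hI hls rls) in gap.
pose lq := in_tuple (l0 :: lt).
have hlq i : tnth lq i \is 1.-homog by apply/hls/mem_tnth.
have iIg := add_gen_ideal g iI.
have [D [hD D0 ID]] : exists D : {mpoly K[k.+1]},
    [/\ D \is N.-homog, D != 0 & add_gen I g (D \mPo lq)].
  (* Otherwise the forms of degree [N] in [k + 1] variables embed into degree [N] of [S/(I + (g))],
     whose dimension is [HF I N - HF I (N - e)], too small by [gap]. *)
  apply: NNPP => NE.
  have := HF_rank_nullity (F := comp_mpoly lq) (ideal_lin iIg)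
    (fun p => @comp_mpoly_homog _ _ _ _ p N hlq).
  have -> : HF (fun p : {mpoly K[k.+1]} => add_gen I g (p \mPo lq)) N = size (monos k.+1 N).
    rewrite -(HF_zero_ideal K); apply: HF_eq.
    - case: (ideal_lin iIg) => H0 HL; split; first by rewrite comp_mpoly0.
      by move=> c x y Hx Hy; rewrite linearP; apply: HL.
    - exact/ideal_lin/(@zero_homog_ideal K _).1.
    move=> p hp; split=> [Ip|->]; last by rewrite comp_mpoly0; case: iIg.
    by apply: NNPP => /eqP p0; case: NE; exists p.
  have := HF_nzd (N - e) hI hg Ig; rewrite subnK //.
  rewrite size_monosS; lia.
(* The extra factor makes [b ord0] nonzero, so that [l0] can be rescaled by its inverse. *)
have X0D : 'X_ord0 * D != 0.
  by rewrite mulf_neq0 // -msize_poly_eq0 msizeX.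
have [b] := meval_nonzero K_infinite X0D.
rewrite mevalM mevalXU mulf_eq0 negb_or => /andP [b0 Db].
(* Modulo the new [ls], the old parameter of index [i] becomes [b i *: l], so [D] of the old
   parameters becomes the nonzero scalar [D.@[b]] times [l ^+ N]. *)
pose l := (b ord0)^-1 *: l0.
pose c i : K := oapp b 0 (insub i : option 'I_k.+1).
have cE (i : 'I_k.+1) : c i = b i by rewrite /c valK.
pose u i := lt`_i; pose v i := lt`_i - c i.+1 *: l.
have ltE : lt = map u (iota 0 k) by rewrite -[LHS](mkseq_nth 0).
pose ls := map v (iota 0 k).
have hl0 : l0 \is 1.-homog by apply: hls; rewrite mem_head.
have hl : l \is 1.-homog by apply: rpredZ.
have [Eg Er] : add_gens (add_gen I l) (map u (iota 0 k)) = add_gens (add_gen I l) ls /\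
    (reg (add_gen I l) (map u (iota 0 k)) -> reg (add_gen I l) ls).
  apply: reg_congr; first exact: add_gen_ideal.
  move=> i; exists 0, (c i.+1)%:MP; split; first by case: iI.
  by rewrite /u /v opprB addrC subrK mul_mpolyC add0r.
have Il0 : add_gen I l = add_gen I l0 by rewrite add_gen_scale // invr_neq0.
have rl : reg I (l :: ls).
  case: rls => Il rlt; split; first by apply: nzd_scale => //; rewrite invr_neq0.
  by apply: Er; rewrite -ltE Il0.
have hls' l' : l' \in l :: ls -> l' \is 1.-homog.
  rewrite inE => /predU1P [->|/mapP [i]] //; rewrite mem_iota add0n => /= ik ->.
  apply: rpredB; last exact: rpredZ.
  by apply: hls; rewrite inE mem_nth ?orbT.
exists l, ls; split=> //; first by rewrite size_map size_iota.
  by rewrite /= -Eg -ltE Il0.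
set A := add_gens I ls; have iA : is_ideal A by apply: add_gens_ideal.
have [_ [Al _]] : reg I ls /\ reg A [:: l].
  apply/reg_cat; rewrite cats1; apply: reg_perm rl => //.
    exact: linear_homog_seq.
  by rewrite perm_sym perm_rcons.
case: ID => i [r [Ii Dir]].
apply: (@nzd_of_power _ _ A g l (D.@[b]^-1 *: r) N iA _ Al).
have : A ((D \mPo lq) - (D \mPo [tuple b i *: l | i < k.+1])).
  apply: comp_mpoly_congr => // j; rewrite tnth_mktuple (tnth_nth 0) /=.
  case: (unliftP ord0 j) => [j'|] -> /=; last first.
    by rewrite /l scalerA divff // scale1r subrr; case: iA.
  rewrite -cE /= /bump leq0n add1n.
  rewrite add0n; apply: mem_add_gens => //; apply/mapP; exists (j' : nat) => //.
  by rewrite mem_iota add0n; apply: (ltn_ord j').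
rewrite (comp_mpoly_scale _ _ hD) Dir => AD.
have -> : l ^+ N - D.@[b]^-1 *: r * g =
    - ((D.@[b]^-1)%:MP * ((i + r * g - D.@[b] *: l ^+ N) - i)).
  rewrite mul_mpolyC addrAC [i + _]addrC addrK scalerBr scalerA mulVf // scale1r.
  by rewrite opprB scalerAl.
apply: idealN => //; apply: idealMl => //; apply: idealB => //.
exact: sub_add_gens.
Qed.

(** Induction on [fs], starting from all the variables: each new [g] takes the place of one linear
    form. The total number of parameters stays [n], while the vanishing bound and the socle degree
    both move by [e - 1]. *)
Lemma linear_parameters fs d : homog_degs fs d -> all (leq 1) d -> reg Z fs ->
  exists ls, [/\ (size ls + size fs)%N = n, (forall l, l \in ls -> l \is 1.-homog),
    reg Z (fs ++ ls),
    (forall j, (\sum_(e <- d) e.-1 < j)%N -> HF (add_gens Z (fs ++ ls)) (Posz j) = 0%N)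
    & socle_in_degree (add_gens Z (fs ++ ls)) (\sum_(e <- d) e.-1)].
Proof.
have hZ := @zero_homog_ideal K n.
elim/last_ind: fs d => [|fs g IH] d.
  case: d => [|? ?] [] //= _ _ _ _; rewrite big_nil.
  exists (vars K (enum 'I_n)); rewrite size_map size_enum_ord addn0; split=> //.
  - by move=> _ /mapP [i _ ->]; rewrite dhomogX; apply/eqP/mdeg1.
  - by have := @reg_vars K n [::] (enum 'I_n); apply; rewrite enum_uniq.
  - move=> j j0; apply: HF_full; first by apply/ideal_lin/add_gens_ideal; case: hZ.
    move=> p hp; apply/add_gens_varsP; rewrite comp_mpolyE big_seq big1 // => m mp.
    have Em : mdeg m = j := dhomog_mf hp mp.
    have [i mi] : exists i, m i != 0%N.
      apply: NNPP => N; move: j0; rewrite -Em mdegE big1 // => i _.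
      by apply/eqP; apply: contra_notT N => mi; exists i.
    by rewrite (bigD1 i) //= tnth_mktuple mem_enum expr0n (negbTE mi) mul0r scaler0.
  - move=> s k hs ns _; apply/eqP; apply: contra_notT ns => k0.
    apply/add_gens_varsP; rewrite comp_mpolyE big_seq big1 // => m mp.
    have Em : mdeg m = k := dhomog_mf hs mp.
    have [i mi] : exists i, m i != 0%N.
      apply: NNPP => N; case/eqP: k0; rewrite -Em mdegE big1 // => i _.
      by apply/eqP; apply: contra_notT N => mi; exists i.
    by rewrite (bigD1 i) //= tnth_mktuple mem_enum expr0n (negbTE mi) mul0r scaler0.
case/lastP: d => [|d e]; first by case; rewrite size_rcons.
move=> hfg dpos; have [hg hf] := homog_degs_rcons hfg.
move: dpos; rewrite all_rcons => /andP [e0 dpos].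
rewrite -[rcons fs g]cats1 => /reg_cat [rf [/= Ig _]].
have hfs := homog_degs_seq hf dpos.
have [ls [sz hls rls fin soc]] := IH d hf dpos rf.
set I := add_gens Z fs in Ig *; set a := \sum_(x <- d) x.-1 in fin soc.
have hI : homog_ideal I by apply: add_gens_homog.
have iI := hI.1.
case: ls sz hls rls fin soc => [|l0 lt] sz hls rls fin soc.
  (* With no linear form left, [S/I] vanishes above degree [a], so [g ^+ a.+1], of degree
     [e * a.+1], lies in [I]; as [g] is a nonzerodivisor, 1 would lie in [I]. *)
  have one : ~ I 1 by apply: add_gens_proper.
  case: one; apply: (nzd_exp (k := a.+1) Ig); rewrite mul1r.
  rewrite cats0 in fin.
  apply: (HF0_in (d := e * a.+1) (ideal_lin iI) _ (dhomogMn _ hg)).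
  by apply: fin; rewrite -[X in (X <= _)%N]mul1n leq_mul2r.
move/reg_cat: rls => [_ rl]; rewrite add_gens_cat -/I in fin soc.
have [l [ls [szl hl rll El Ag]]] := exchange_parameter hI hg e0 Ig hls rl fin.
rewrite -El in fin soc; set A := add_gens I ls in Ag.
have hls' l' : l' \in ls -> l' \is 1.-homog by move=> ll; apply: hl; rewrite inE ll orbT.
have hA : homog_ideal A by apply: add_gens_homog => //; apply: linear_homog_seq.
have hl1 : l \is 1.-homog by apply: hl; rewrite mem_head.
have EA : add_gens I (l :: ls) = add_gen A l by rewrite /= add_gens_add_gen.
have Egl : add_gens Z ((fs ++ [:: g]) ++ ls) = add_gen A g.
  by rewrite !add_gens_cat /= add_gens_add_gen.
have [rls [Al _]] : reg I ls /\ reg A [:: l].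
  apply/reg_cat; rewrite cats1; apply: reg_perm rll => //.
    exact: linear_homog_seq.
  by rewrite perm_sym perm_rcons.
have sumE : \sum_(x <- rcons d e) x.-1 = (a + e).-1.
  by rewrite -cats1 big_cat big_seq1 /= -/a; lia.
exists ls; rewrite Egl sumE; split=> //.
- by rewrite size_cat /= szl addn1 addnS; apply: sz.
- rewrite -catA; apply/reg_cat; split=> //=; split=> //.
  have : reg I (ls ++ [:: g]) by apply/reg_cat.
  move/(reg_perm hI); case/(_ (g :: ls)) => //; last by rewrite perm_catC.
  by apply: homog_seq_cat; [exact: linear_homog_seq | move=> x; rewrite inE => /eqP ->; exists e].
- move=> j lj; rewrite EA in fin.
  have le : (e <= j)%N by lia.
  have := HF_nzd (j - e) hA hg Ag; rewrite subnK //.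
  (* [HF A] is constant from degree [a] on, since [HF] of [A + (l)] vanishes above [a]; the values
     at [j] and [j - e] therefore cancel. *)
  rewrite !(HF_linear_form_eq hA hl1 Al) (sumop_const (a := a)) //; last by lia.
  rewrite (sumop_const (a := a) fin (j := j)); lia.
- by apply: (socle_exchange hA hg e0 hl1 Ag Al); rewrite -EA.
Qed.

End NoetherPosition.

(** * Colon ideals and linear sections *)

Section ColonSpecialization.
Variables (K : fieldType) (n : nat).
Local Notation S := {mpoly K[n]}.
Implicit Types (I J : S -> Prop) (G H l : S).

Lemma colon_divide I l G D : homog_ideal I -> l \is 1.-homog -> nzd I l ->
  G \is D.-homog -> ~ I G -> exists G1 D1,
    [/\ (D1 <= D)%N, G1 \is D1.-homog, ~ add_gen I l G1 & colon I G = colon I G1].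
Proof.
move=> hI hl Il; have iI := hI.1; elim: D G => [|D IH] G hG nIG; last first.
  case: (classic (add_gen I l G)) => [[i [r [Ii E]]]|nl]; last first.
    by exists G, D.+1; split.
  have {}E : G = 'pi_D.+1 i + 'pi_D r * l.
    by rewrite -[D.+1]addn1 -(pihomogMD _ _ hl) -linearD /= -E pihomog_dE ?addn1.
  have Ii' : I ('pi_D.+1 i) by apply: hI.2.
  have CE : colon I G = colon I ('pi_D r).
    apply: pred_ext => p; rewrite /colon E mulrDr; split.
      move=> H; apply: Il; rewrite -mulrA -[p * (_ * _)](addKr (p * 'pi_D.+1 i)).
      rewrite addrC; apply: idealB => //; exact: idealMl.
    move=> H; apply: idealD => //; first exact: idealMl.
    by rewrite mulrA; apply: idealMr.
  have [|G1 [D1 [le h1 n1 E1]]] := IH ('pi_D r) (pihomogP _ _ _).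
    by move=> H; apply: nIG; rewrite E; apply: idealD => //; apply: idealMr.
  by exists G1, D1; split=> //; [exact: leqW | rewrite CE].
(* In degree 0 a multiple of [l] contributes nothing, so membership in [I + (l)] is membership in
   [I]. *)
exists G, 0%N; split=> // -[i [r [Ii E]]]; apply: nIG.
rewrite -(pihomog_dE hG) E linearD /= (pihomogM_homog _ _ hl) addr0.
exact: hI.2.
Qed.

Lemma sub_colon_add_gen I l G p :
  is_ideal I -> add_gen (colon I G) l p -> colon (add_gen I l) G p.
Proof.
move=> iI; apply: add_gen_min; first exact/colon_ideal/add_gen_ideal.
  by move=> q; apply: (@sub_add_gen _ _ I l (q * G)).
by exists 0, G; rewrite add0r mulrC; split=> //; case: iI.
Qed.

Lemma colon_specialize I ls G D : homog_ideal I ->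
  (forall l, l \in ls -> l \is 1.-homog) -> reg I ls -> G \is D.-homog -> ~ I G ->
  exists G' D', [/\ (D' <= D)%N, G' \is D'.-homog, ~ add_gens I ls G' &
    forall j, (iter (size ls) sumop (fun j => HF (colon (add_gens I ls) G') (Posz j)) j
      <= HF (colon I G) (Posz j))%N].
Proof.
elim: ls I G D => [|l ls IH] I G D hI hls /= rls hG nIG; first by exists G, D; split.
have hl : l \is 1.-homog by apply: hls; rewrite mem_head.
have [Il rl] := rls; have [G1 [D1 [le1 h1 n1 ->]]] := colon_divide hI hl Il hG nIG.
have hIl := add_gen_homog hl hI.
have [|G' [D' [le' h' n' E']]] := IH _ G1 D1 hIl _ rl h1 n1.
  by move=> y ys; apply: hls; rewrite inE ys orbT.
exists G', D'; split=> // [|j]; first exact: leq_trans le' le1.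
have hC := colon_homog h1 hI.
(* Since [l] is a nonzerodivisor modulo [I], it is also one modulo the colon ideal; hence an
   equality at this point and the lower bound afterwards. *)
rewrite (HF_linear_form_eq hC hl) => [|p]; last first.
  by rewrite /colon mulrAC; apply: Il.
apply: leq_sum => i _; apply: leq_trans (E' i) _.
apply: HF_ideal_mono; [exact: (add_gen_ideal l hC.1) | exact: (colon_ideal G1 hIl.1) |].
by move=> p; apply: sub_colon_add_gen; case: hI.
Qed.

Lemma socle_raise J a G D D' : socle_in_degree J a -> G \is D'.-homog -> ~ J G ->
  (D' <= D <= a)%N -> exists2 H, H * G \is D.-homog & ~ J (H * G).
Proof.
move=> soc hG nG /andP [DD' Da].
rewrite -(subnKC DD') in Da *; elim: (D - D')%N Da => [|k IH] Da.
  by exists 1; rewrite mul1r ?addn0.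
have [|H hH nH] := IH; first by lia.
have [i ni] : exists i, ~ J ('X_i * (H * G)).
  apply: NNPP => N; suff : (D' + k)%N = a by lia.
  by apply: (soc _ _ hH nH) => i; apply: NNPP => ni; case: N; exists i.
exists ('X_i * H); rewrite -mulrA //.
have hX : ('X_i : S) \is 1.-homog by rewrite dhomogX; apply/eqP/mdeg1.
by rewrite addnS -add1n; apply: dhomogM.
Qed.

End ColonSpecialization.

(** * Linear forms and coordinates on the subspace that they cut out *)

Section LinearForms.
Variable K : fieldType.

Definition lin_form m (v : 'rV[K]_m) : {mpoly K[m]} := \sum_i v 0 i *: 'X_i.

Lemma lin_form_is_linear m : linear (@lin_form m).
Proof.
move=> c u v; rewrite /lin_form scaler_sumr -big_split; apply: eq_bigr => i _.
by rewrite !mxE scalerDl scalerA.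
Qed.
HB.instance Definition _ m := GRing.isLinear.Build K _ _ _ _ (@lin_form_is_linear m).

Lemma lin_form_homog m (v : 'rV[K]_m) : lin_form v \is 1.-homog.
Proof.
by apply: rpred_sum => i _; apply: rpredZ; rewrite dhomogX; apply/eqP/mdeg1.
Qed.

Lemma lin_form_delta m (i : 'I_m) : lin_form (delta_mx 0 i) = 'X_i.
Proof.
rewrite /lin_form (bigD1 i) //= mxE !eqxx scale1r big1 ?addr0 // => j ne.
by rewrite mxE eqxx (negbTE ne) scale0r.
Qed.

Lemma comp_lin_form m k (M : 'M[K]_(m, k)) (v : 'rV[K]_m) :
  lin_form v \mPo [tuple lin_form (row i M) | i < m] = lin_form (v *m M).
Proof.
rewrite {1}/lin_form linear_sum mulmx_sum_row linear_sum; apply: eq_bigr => i _.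
by rewrite !linearZ /= comp_mpolyXU -tnth_nth tnth_mktuple.
Qed.

(** A relation with nonzero last coefficient puts the last form into the ideal of the earlier ones;
    being a nonzerodivisor modulo that ideal, it would force 1 into it. *)
Lemma reg_linear_forms_free n (ls : seq {mpoly K[n]}) (c : nat -> K) :
  (forall l, l \in ls -> l \is 1.-homog) -> reg (@zero_ideal K n) ls ->
  \sum_(i < size ls) c i *: ls`_i = 0 -> forall i, (i < size ls)%N -> c i = 0.
Proof.
elim/last_ind: ls => [//|s l IH] hls.
rewrite -cats1 => /reg_cat [rs [/= rl _]].
have hs x : x \in s -> x \is 1.-homog by move=> xs; apply: hls; rewrite mem_rcons inE xs orbT.
have iA := add_gens_ideal s (@zero_homog_ideal K n).1.
rewrite size_cat addn1 big_ord_recr /= nth_cat ltnn subnn /=.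
rewrite (eq_bigr (fun i : 'I_(size s) => c i *: s`_i)); last first.
  by move=> i _; rewrite nth_cat ltn_ord.
move=> E; have c0 : c (size s) = 0.
  apply/eqP; apply: contraT => c0.
  case: (@add_gens_proper K n s); first by move=> x /hs; exists 1%N.
  apply: rl; rewrite mul1r; move/eqP: E; rewrite addrC addr_eq0 => /eqP E.
  rewrite -[l]scale1r -(mulVf c0) -scalerA E -mul_mpolyC; apply: idealMl => //.
  apply: idealN => //; apply: ideal_sum => // i _; rewrite -mul_mpolyC.
  apply: idealMl => //; apply: mem_add_gens; first by case: (@zero_homog_ideal K n).
  exact: mem_nth.
move: E; rewrite c0 scale0r addr0 => /(IH hs rs) H i.
by rewrite ltnS leq_eqVlt => /predU1P [->|/H].
Qed.

(* [lp] restricts polynomials to the linear subspace [ls = 0], with coordinates [li]. *)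
Definition linear_section n h (ls : seq {mpoly K[n]})
    (lp : n.-tuple {mpoly K[h]}) (li : h.-tuple {mpoly K[n]}) :=
  [/\ (forall i, tnth lp i \is 1.-homog), (forall i, tnth li i \is 1.-homog),
      (forall q, (q \mPo li) \mPo lp = q),
      (forall l, l \in ls -> l \mPo lp = 0)
    & (forall p, add_gens (@zero_ideal K n) ls (p - ((p \mPo lp) \mPo li)))].

Lemma linear_section_exists n h (ls : seq {mpoly K[n]}) : (size ls + h)%N = n ->
  (forall l, l \in ls -> l \is 1.-homog) -> reg (@zero_ideal K n) ls ->
  exists (lp : n.-tuple {mpoly K[h]}) (li : h.-tuple {mpoly K[n]}),
    linear_section ls lp li.
Proof.
move=> En hls rls; have fr c := reg_linear_forms_free (c := c) hls rls.
move: (erefl (size ls)) En; move: {2 3}(size ls) => k Ek En; subst n.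
pose B : 'M[K]_(k, k + h) := \matrix_(i, j) (ls`_i)@_U_(j).
have lsE i : (i < k)%N -> ls`_i \is 1.-homog by move=> ik; apply/hls/mem_nth; rewrite Ek.
have BE (i : 'I_k) : lin_form (row i B) = ls`_i.
  rewrite (homog1E (lsE i (ltn_ord i))); apply: eq_bigr => j _; by rewrite !mxE.
have rfB : row_free B.
  apply: inj_row_free => v vB; apply/rowP => i; rewrite mxE.
  have := fr (fun i => oapp (v 0) 0 (insub i)); rewrite Ek => /(_ _ i (ltn_ord i)).
  rewrite valK; apply; have E0 : lin_form (v *m B) = 0 by rewrite vB linear0.
  rewrite -[RHS]E0 mulmx_sum_row linear_sum; apply: eq_bigr => j _.
  by rewrite linearZ /= BE valK.
pose R := row_ebase B; pose L := col_ebase B.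
have Ru : R \in unitmx by apply: row_ebase_unit.
have Lu : L \in unitmx by apply: col_ebase_unit.
have Beq : B = L *m row_mx 1%:M 0 *m R.
  by rewrite -[LHS]mulmx_ebase (eqP rfB) pid_mx_row.
(* Acting on row vectors, that is on linear forms, [C] is the quotient by the row space of [B], [M]
   splits it, and [1 - C M] factors through [B]. The basis change [R] reduces [B] to its first [k]
   coordinates. *)
pose C : 'M[K]_(k + h, h) := invmx R *m col_mx 0 1%:M.
pose M : 'M[K]_(h, k + h) := row_mx 0 1%:M *m R.
have BC : B *m C = 0.
  rewrite Beq /C mulmxA mulmxK // -mulmxA mul_row_col mulmx0 mul0mx addr0 mulmx0 //.
have MC : M *m C = 1%:M.
  by rewrite /M /C mulmxA mulmxK // mul_row_col mul0mx mulmx1 add0r.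
have CM : exists E, 1%:M - C *m M = E *m B.
  exists (invmx R *m col_mx 1%:M 0 *m invmx L).
  have blk : 1%:M - col_mx 0 1%:M *m row_mx 0 1%:M
      = col_mx 1%:M 0 *m row_mx 1%:M 0 :> 'M[K]_(k + h).
    rewrite !mul_col_row !mul0mx !mul1mx scalar_mx_block opp_block_mx add_block_mx.
    by rewrite !subr0 !subrr.
  by rewrite Beq !mulmxA mulmxKV // -[X in _ = X *m R]mulmxA -blk mulmxBr mulmx1 mulmxBl mulVmx // !mulmxA.

pose lp := [tuple lin_form (row i C) | i < k + h].
pose li := [tuple lin_form (row i M) | i < h].
exists lp; exists li; split.
- by move=> i; rewrite tnth_mktuple lin_form_homog.
- by move=> i; rewrite tnth_mktuple lin_form_homog.
- move=> q; rewrite -[RHS]comp_mpoly_id.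
  have := @mpoly_rmorph_eq _ _ _ (comp_mpoly lp \o comp_mpoly li)
    (comp_mpoly [tuple 'X_i | i < h]).
  apply=> [c|i] /=; first by rewrite !comp_mpolyC.
  rewrite !comp_mpolyXU -!tnth_nth !tnth_mktuple comp_lin_form -row_mul MC.
  by rewrite row1 lin_form_delta.
- move=> l /(nthP 0) [i]; rewrite Ek => ik <-.
  by rewrite -[i]/(val (Ordinal ik)) -BE comp_lin_form -row_mul BC row0 linear0.
have i0 := (@zero_homog_ideal K (k + h)).1.
move=> p; have iA := add_gens_ideal ls i0.
rewrite -{1}(comp_mpoly_id p).
have -> : (p \mPo lp) \mPo li = p \mPo [tuple (tnth lp i) \mPo li | i < k + h].
  have := @mpoly_rmorph_eq _ _ _ (comp_mpoly li \o comp_mpoly lp)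
    (comp_mpoly [tuple (tnth lp i) \mPo li | i < k + h]).
  apply=> [c|i] /=; first by rewrite !comp_mpolyC.
  by rewrite !comp_mpolyXU -!tnth_nth !tnth_mktuple.
apply: comp_mpoly_congr => // i; rewrite !tnth_mktuple comp_lin_form.
have [E CE] := CM.
rewrite -lin_form_delta -linearB /= -row_mul -[delta_mx 0 i]mulmx1 rowE -mulmxBr CE.
rewrite mulmxA mulmx_sum_row linear_sum; apply: ideal_sum => // j _.
rewrite linearZ /= BE -mul_mpolyC; apply: idealMl => //.
by apply: mem_add_gens => //; apply: mem_nth; rewrite Ek.
Qed.

End LinearForms.

Section LinearSection.
Variables (K : fieldType) (n h : nat) (ls : seq {mpoly K[n]}).
Variables (lp : n.-tuple {mpoly K[h]}) (li : h.-tuple {mpoly K[n]}).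
Hypothesis sec : linear_section ls lp li.
Hypothesis hls : forall l, l \in ls -> l \is 1.-homog.
Local Notation Zn := (@zero_ideal K n).
Local Notation Zh := (@zero_ideal K h).
Local Notation pi := (comp_mpoly lp).
Local Notation io := (comp_mpoly li).

Let iZn : is_ideal Zn. Proof. by case: (@zero_homog_ideal K n). Qed.
Let iZh : is_ideal Zh. Proof. by case: (@zero_homog_ideal K h). Qed.

Lemma preim_ideal m1 m2 (f : {rmorphism {mpoly K[m1]} -> {mpoly K[m2]}}) I :
  is_ideal I -> is_ideal (fun p => I (f p)).
Proof.
case=> I0 ID IM; split; first by rewrite rmorph0.
  by move=> x y Ix Iy; rewrite rmorphD; apply: ID.
by move=> r x Ix; rewrite rmorphM; apply: IM.
Qed.

(** The isomorphism of [S/(ls)] with the polynomial ring in [h] variables, read on ideals: [p] and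
    [io (pi p)] differ by an element of [(ls)]. *)
Lemma section_mem s p : add_gens Zh (map pi s) (pi p) <-> add_gens Zn (ls ++ s) p.
Proof.
have [_ _ pio pil res] := sec.
have iJ : is_ideal (add_gens Zn (ls ++ s)) by apply: add_gens_ideal.
have Jls q : add_gens Zn ls q -> add_gens Zn (ls ++ s) q.
  by rewrite add_gens_cat; apply: sub_add_gens.
split.
  move=> H; apply/(ideal_sub_congr iJ (Jls _ (res p))).
  have iJ' := preim_ideal (comp_mpoly li) iJ.
  apply: (add_gens_min iJ' _ _ H) => [q ->|_ /mapP [x xs ->]].
    by rewrite /= comp_mpoly0; case: iJ.
  apply/(ideal_sub_congr iJ (Jls _ (res x))).
  by apply: mem_add_gens => //; rewrite mem_cat xs orbT.
have iB : is_ideal (add_gens Zh (map pi s)) by apply: add_gens_ideal.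
have iB' := preim_ideal (comp_mpoly lp) iB.
apply: (add_gens_min iB') => [q ->|x]; first by rewrite /= comp_mpoly0; case: iB.
rewrite mem_cat /= => /orP [/pil ->|xs]; first by case: iB.
by apply: mem_add_gens => //; apply: map_f.
Qed.

Lemma map_section (t : seq {mpoly K[h]}) : map pi (map io t) = t.
Proof.
have [_ _ pio _ _] := sec.
by rewrite -map_comp -[RHS]map_id; apply: eq_map => q /=.
Qed.

Lemma section_reg t s :
  reg (add_gens Zn (ls ++ t)) s <-> reg (add_gens Zh (map pi t)) (map pi s).
Proof.
have [_ _ pio _ _] := sec.
elim: s t => //= x s IH t.
have := IH (rcons t x); rewrite map_rcons -!cats1 catA !add_gens_cat /= => ->.
suff -> : nzd (add_gens (add_gens Zn ls) t) x <-> nzd (add_gens Zh (map pi t)) (pi x) by [].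
rewrite -add_gens_cat; split=> H.
  move=> q; rewrite -[q]pio -rmorphM => /section_mem /H.
  by move/section_mem.
move=> p /section_mem; rewrite rmorphM => /H.
by move/section_mem.
Qed.

Lemma section_HF (I : {mpoly K[h]} -> Prop) (j : nat) : lin_closed I ->
  HF (fun p => I (pi p)) j = HF I j.
Proof.
have [hp hi pio _ _] := sec; move=> lI.
apply: (@HF_preim _ _ _ I (comp_mpoly lp)) => //.
  by move=> p; apply: comp_mpoly_homog.
move=> q hq; exists (io q); first exact: comp_mpoly_homog.
by rewrite /= pio subrr; case: lI.
Qed.

(** Cutting by [ls] bounds [HF I] by iterated sums for [I + (ls)], and that ideal contains the
    pullback of [I0]. It supplies the upper bounds for ideals extended from [h] variables. *)
Lemma section_HF_le (I : {mpoly K[n]} -> Prop) (I0 : {mpoly K[h]} -> Prop) :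
  homog_ideal I -> is_ideal I0 -> (forall q, I0 q -> I (io q)) ->
  forall j, (HF I (Posz j) <= iter (size ls) sumop (fun j => HF I0 (Posz j)) j)%N.
Proof.
have [_ _ pio _ res] := sec.
move=> hI iI0 H j; apply: leq_trans (HF_linear_forms_le hI hls j) _.
apply: iter_sumop_le => {}j; rewrite -(section_HF j (ideal_lin iI0)).
have iA := add_gens_ideal ls hI.1.
apply: HF_ideal_mono => //; first exact: (preim_ideal (comp_mpoly lp)).
move=> p /H Ip; have : add_gens I ls (p - io (pi p)).
  apply: (add_gens_min iA) (res p) => [q ->|x xs]; first by case: iA.
  by apply: mem_add_gens; case: hI.
by move=> Ap; apply/(ideal_sub_congr iA Ap); exact: sub_add_gens.
Qed.

End LinearSection.

(** * Extension of polynomials to more variables *)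

Section Extension.
Variables (K : fieldType) (n h : nat).
Hypothesis hn : (h <= n)%N.

Definition ext_tuple : h.-tuple {mpoly K[n]} := [tuple ext_var K n i | i < h].

Definition cut_tuple : n.-tuple {mpoly K[h]} :=
  [tuple if insub (val i) is Some j then 'X_j else 0 | i < n].

Definition last_vars : seq {mpoly K[n]} := vars K [seq i : 'I_n <- enum 'I_n | (h <= i)%N].

Lemma size_last_vars : size last_vars = (n - h)%N.
Proof.
rewrite size_map size_filter -(count_map val (leq h)) val_enum_ord.
rewrite -[in LHS](subnKC hn) iotaD count_cat add0n.
have -> : count (leq h) (iota 0 h) = 0%N.
  by apply/eqP; rewrite -leqn0 leqNgt -has_count; apply/hasPn => i; rewrite mem_iota; lia.
have /eqP -> : count (leq h) (iota h (n - h)) == size (iota h (n - h)).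
  by rewrite -all_count; apply/allP => i; rewrite mem_iota; lia.
by rewrite size_iota.
Qed.

Lemma last_vars_homog l : l \in last_vars -> l \is 1.-homog.
Proof. by case/mapP => i _ ->; rewrite dhomogX; apply/eqP/mdeg1. Qed.

Lemma ext_varE (i : 'I_h) : ext_var K n i = 'X_(widen_ord hn i).
Proof.
rewrite /ext_var; case: insubP => [j _ Ej|]; last by rewrite (leq_trans (ltn_ord i)).
by congr 'X_ _; apply: val_inj.
Qed.

(** Treats [ext_poly] as the section by the last [n - h] variables, so that the results obtained for
    the parameters [ls] apply to it too. *)
Lemma ext_section : linear_section last_vars cut_tuple ext_tuple.
Proof.
have X1 m (i : 'I_m) : ('X_i : {mpoly K[m]}) \is 1.-homog.
  by rewrite dhomogX; apply/eqP/mdeg1.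
split.
- by move=> i; rewrite tnth_mktuple; case: insubP => [j _ _|_]; rewrite ?rpred0.
- by move=> i; rewrite tnth_mktuple ext_varE.
- move=> q; rewrite -[RHS]comp_mpoly_id.
  have := @mpoly_rmorph_eq _ _ _ (comp_mpoly cut_tuple \o comp_mpoly ext_tuple)
    (comp_mpoly [tuple 'X_i | i < h]).
  apply=> [c|i] /=; first by rewrite !comp_mpolyC.
  by rewrite comp_mpolyXU -tnth_nth tnth_mktuple ext_varE !comp_mpolyXU -!tnth_nth !tnth_mktuple /= valK.
- move=> l /mapP [i]; rewrite mem_filter => /andP [hi _] {l}->.
  by rewrite comp_mpolyXU -tnth_nth tnth_mktuple insubN // -leqNgt.
move=> p; have iZ := (@zero_homog_ideal K n).1; have iA := add_gens_ideal last_vars iZ.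
rewrite -{1}(comp_mpoly_id p).
have -> : (p \mPo cut_tuple) \mPo ext_tuple
    = p \mPo [tuple (tnth cut_tuple i) \mPo ext_tuple | i < n].
  have := @mpoly_rmorph_eq _ _ _ (comp_mpoly ext_tuple \o comp_mpoly cut_tuple)
    (comp_mpoly [tuple (tnth cut_tuple i) \mPo ext_tuple | i < n]).
  apply=> [c|i] /=; first by rewrite !comp_mpolyC.
  by rewrite !comp_mpolyXU -!tnth_nth !tnth_mktuple.
apply: comp_mpoly_congr => // i; rewrite !tnth_mktuple.
case: insubP => [j ij Ej|].
  rewrite comp_mpolyXU -tnth_nth tnth_mktuple ext_varE.
  rewrite (_ : widen_ord hn j = i) ?subrr; [by case: iA | exact: val_inj].
rewrite -leqNgt => hi; rewrite comp_mpoly0 subr0.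
by apply: mem_add_gens => //; apply: map_f; rewrite mem_filter hi mem_enum.
Qed.

Lemma reg_last_vars : reg (@zero_ideal K n) last_vars.
Proof.
have := @reg_vars K n [::] [seq i : 'I_n <- enum 'I_n | (h <= i)%N]; apply.
by rewrite filter_uniq ?enum_uniq.
Qed.

Lemma ext_poly_homog p d : p \is d.-homog -> @ext_poly K h n p \is d.-homog.
Proof. by apply: comp_mpoly_homog; case: ext_section. Qed.

Lemma reg_ext (fs : seq {mpoly K[h]}) : homog_seq fs ->
  reg (@zero_ideal K h) fs -> reg (@zero_ideal K n) (map (@ext_poly K h n) fs).
Proof.
move=> hfs rfs; have hZ := @zero_homog_ideal K n.
set es := map _ fs; have hes : homog_seq es.
  by move=> _ /mapP [x /hfs [d d0 hx] ->]; exists d => //; apply: ext_poly_homog.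
have hv : homog_seq last_vars by apply: linear_homog_seq last_vars_homog.
have : reg (@zero_ideal K n) (last_vars ++ es).
  apply/reg_cat; split; first exact: reg_last_vars.
  have [_] := section_reg ext_section [::] es; rewrite cats0; apply.
  by rewrite (map_section ext_section).
move=> rv; have /reg_cat [] // : reg (@zero_ideal K n) (es ++ last_vars).
apply: (reg_perm hZ _ _ rv); first exact: homog_seq_cat.
by rewrite perm_catC.
Qed.

End Extension.

Lemma HF_colon_le (K : fieldType) n (I : {mpoly K[n]} -> Prop) G D j :
  homog_ideal I -> G \is D.-homog ->
  HF (add_gen I G) (Posz j)
    = (HF I (Posz j) - (if (D <= j)%N then HF (colon I G) (Posz (j - D)) else 0))%N.
Proof.
move=> hI hG; case: leqP => [le|lt]; last by rewrite subn0 (HF_add_gen_low hI hG).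
by have := HF_colon_add_gen (j - D) hI hG; rewrite subnK // => <-; rewrite addKn.
Qed.

(** * Construction of the Artinian ideal and comparison of Hilbert functions *)

Section Specialization.
Variable K : fieldType.
Hypothesis K_infinite : forall s : seq K, exists x : K, x \notin s.
Variable n : nat.
Variables (d : seq nat) (D : nat) (fs : seq {mpoly K[n]}) (G : {mpoly K[n]}).
Hypotheses (hfs : homog_degs fs d) (d_gt0 : all (leq 1) d).
Hypotheses (rfs : reg (@zero_ideal K n) fs) (hG : G \is D.-homog).
Hypothesis nG : ~ add_gens (@zero_ideal K n) fs G.
Hypothesis D_le : (D <= \sum_(e <- d) e.-1)%N.
Local Notation h := (size d).
Local Notation Zh := (@zero_ideal K h).
Local Notation Zn := (@zero_ideal K n).

Lemma artinian_specialization : (h <= n)%N /\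
  exists fb Gb, [/\ homog_degs fb d, reg Zh fb, Gb \is D.-homog, ~ add_gens Zh fb Gb &
    [/\ forall j, (\sum_(e <- d) e.-1 < j)%N -> HF (add_gens Zh fb) (Posz j) = 0%N,
      forall j, (HF (add_gen (add_gens Zn fs) G) (Posz j) <=
        HF (add_gens Zn (map (@ext_poly K h n) (rcons fb Gb))) (Posz j))%N &
      forall j, (HF (add_gen (add_gens Zn fs) G) (Posz j) <=
        iter (n - h) sumop (fun j => HF (add_gen (add_gens Zh fb) Gb) (Posz j)) j)%N]].
Proof.
have hZn := @zero_homog_ideal K n; have hZh := @zero_homog_ideal K h.
have hsfs := homog_degs_seq hfs d_gt0.
have [ls [sz hls rfl fin soc]] := linear_parameters K_infinite hfs d_gt0 rfs.
have szh : (size ls + h)%N = n by rewrite -hfs.1.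
have hn : (h <= n)%N by lia.
have szl : size ls = (n - h)%N by lia.
split=> //; set I := add_gens Zn fs.
have hI : homog_ideal I by apply: add_gens_homog.
move: (rfl) => /reg_cat [_ rl]; rewrite add_gens_cat in fin soc.
have [G1 [D1 [D1D hG1 nG1 HG1]]] := colon_specialize hI hls rl hG nG.
have [|H hG2 nG2] := socle_raise (D := D) soc hG1 nG1; first by rewrite D1D.
set G2 := H * G1 in hG2 nG2; set J := add_gens I ls in nG1 HG1 nG2 fin.
have hJ : homog_ideal J by apply: add_gens_homog => //; apply: linear_homog_seq.
have hlsseq := linear_homog_seq hls.
have rlf : reg Zn (ls ++ fs).
  apply: (reg_perm hZn _ _ rfl); first exact: homog_seq_cat.
  by rewrite perm_catC.
have rls : reg Zn ls by move/reg_cat: rlf => [].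
have [lp [li sec]] := linear_section_exists szh hls rls.
have JE : J = add_gens Zn (ls ++ fs).
  by rewrite /J /I -add_gens_cat; apply: add_gens_perm; rewrite perm_catC.
pose fb := map (comp_mpoly lp) fs; pose Gb := G2 \mPo lp.
have hlp : forall i, tnth lp i \is 1.-homog by case: sec.
have hfb : homog_degs fb d.
  case: hfs => sz1 H1; split; first by rewrite size_map.
  move=> i; rewrite size_map => lt; rewrite (nth_map 0) //.
  by apply: comp_mpoly_homog => //; apply: H1.
have hGb : Gb \is D.-homog by apply: comp_mpoly_homog.
have hsfb := homog_degs_seq hfb d_gt0.
have memJ p : add_gens Zh fb (p \mPo lp) <-> J p by rewrite JE; exact: (section_mem sec fs p).
have rfb : reg Zh fb.
  have [H1 _] := section_reg sec [::] fs; apply: H1; rewrite cats0.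
  by move/reg_cat: rlf => [].
have hB : homog_ideal (add_gens Zh fb) by apply: add_gens_homog.
have nGb : ~ add_gens Zh fb Gb by move/memJ.
pose es := map (@ext_poly K h n) fb; pose Ge := @ext_poly K h n Gb.
pose E := add_gens Zn es.
have hes : homog_degs es d.
  case: hfb => sz1 H1; split; first by rewrite size_map.
  move=> i; rewrite size_map => lt; rewrite (nth_map 0) //.
  by apply: ext_poly_homog => //; apply: H1.
have hE : homog_ideal E by apply: add_gens_homog => //; apply: homog_degs_seq hes d_gt0.
have hGe : Ge \is D.-homog by apply: ext_poly_homog.
have res : reg Zn es by apply: reg_ext.
(* With equal Hilbert functions for the two complete intersections, only the colon terms of
   [HF_colon_le] remain to be compared. *)
have HIE j : HF I (Posz j) = HF E (Posz j).
  exact: (HF_reg_degs hZn hZn hfs hes rfs res (fun _ => erefl) j).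
have memE q : add_gens Zh fb q -> E (@ext_poly K h n q).
  move=> Hq; have iE := preim_ideal (comp_mpoly (ext_tuple K n h)) hE.1.
  apply: (add_gens_min iE _ _ Hq) => [y ->|x xs] /=.
    by rewrite comp_mpoly0; case: hE => -[].
  by apply: mem_add_gens; [case: hZn | exact: (map_f (@ext_poly K h n) xs)].
have secE := @ext_section K n h hn.
have Hcolon j : (HF (colon E Ge) (Posz j) <= HF (colon I G) (Posz j))%N.
  apply: leq_trans (HG1 j).
  have hCE := colon_homog hGe hE; have iC := colon_ideal Gb hB.1.
  have := section_HF_le secE (@last_vars_homog K n h) hCE iC.
  rewrite size_last_vars // -szl => /(_ _ j) HH; apply: leq_trans (HH _) _.
    by move=> q /memE; rewrite /colon /ext_poly rmorphM.
  (* As [G2] is a multiple of [G1], the colon of [J] by [G1] lies in the colon by [G2], which is the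
     pullback of the colon by [Gb]. *)
  apply: iter_sumop_le => i; rewrite -(section_HF sec i (ideal_lin iC)).
  apply: HF_ideal_mono; first exact: (colon_ideal G1 hJ.1).
    exact: (preim_ideal (comp_mpoly lp) iC).
  move=> p; rewrite /colon /Gb -rmorphM => Jp; apply/memJ.
  by rewrite /G2 mulrCA; apply: idealMl => //; case: hJ.
have main j : (HF (add_gen I G) (Posz j) <= HF (add_gen E Ge) (Posz j))%N.
  rewrite !(HF_colon_le _ hI hG) !(HF_colon_le _ hE hGe) HIE leq_sub2l //.
  by case: (leqP D j) => // _; apply: Hcolon.
exists fb, Gb; split=> //; split.
- move=> j lt; rewrite -(fin j lt) -(section_HF sec j (ideal_lin hB.1)).
  congr HF; apply: pred_ext => p; exact: memJ.
- by move=> j; rewrite map_rcons -cats1 add_gens_cat; apply: main.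
(* This bound by iterated sums of Artinian values is the one that controls multiplicities. *)
move=> j; apply: leq_trans (main j) _.
have hEG := add_gen_homog hGe hE; have iBG := add_gen_ideal Gb hB.1.
have := section_HF_le secE (@last_vars_homog K n h) hEG iBG.
rewrite size_last_vars // => /(_ _ j); apply.
move=> q; case=> i [r [/memE Ei ->]]; exists (@ext_poly K h n i), (@ext_poly K h n r).
by split=> //; rewrite /ext_poly rmorphD rmorphM.
Qed.

End Specialization.

(** * Primes over an Artinian ideal *)

Section KrullDimension.
Variables (K : fieldType) (n : nat).
Local Notation S := {mpoly K[n]}.
Implicit Types (I P Q : S -> Prop).

Definition free_mod I (l : seq S) := forall c : nat -> K,
  I (\sum_(i < size l) c i *: l`_i) -> forall i, (i < size l)%N -> c i = 0.

Fixpoint powers_times (y : S) (l : seq S) (N : nat) : seq S :=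
  if N is N'.+1 then l ++ [seq y * x | x <- powers_times y l N'] else [::].

Lemma size_powers_times y l N : size (powers_times y l N) = (N * size l)%N.
Proof. by elim: N => //= N IH; rewrite size_cat size_map IH mulSn. Qed.

(** Modulo [Q] only the terms without [y] survive, so their coefficients vanish; the rest is
    divisible by [y], which can be cancelled because [P] is prime. *)
Lemma powers_times_free P Q y l N : is_prime P -> is_ideal Q ->
  (forall p, P p -> Q p) -> Q y -> ~ P y ->
  free_mod Q l -> free_mod P (powers_times y l N).
Proof.
move=> [iP _ pP] iQ PQ Qy nPy lQ; elim: N => [|N IH] c //=.
set M := powers_times y l N in IH *.
rewrite size_cat size_map big_split_ord /=.
rewrite (eq_bigr (fun i : 'I_(size l) => c i *: l`_i)); last first.
  by move=> i _; rewrite nth_cat ltn_ord.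
rewrite [X in _ + X](eq_bigr (fun i : 'I_(size M) => y * (c (size l + i)%N *: M`_i))); last first.
  move=> i _; rewrite nth_cat ltnNge leq_addr /= addKn (nth_map 0) //.
  by rewrite scalerAr.
rewrite -mulr_sumr => PS.
have c0 : forall i, (i < size l)%N -> c i = 0.
  apply: lQ; set s := \sum_(i < _) _ in PS *.
  have := PQ _ PS; set t := y * _ => Qst.
  by rewrite -[s](addrK t); apply: idealB => //; apply: idealMr.
rewrite big1 ?add0r in PS; last by move=> i _; rewrite c0 ?scale0r.
have {PS} [//|PS] := pP _ _ PS.
have c1 := IH (fun i => c (size l + i)%N) PS.
move=> i lt; case: (ltnP i (size l)) => [/c0|le] //.
by rewrite -(subnKC le); apply: c1; rewrite ltn_subLR.
Qed.

Lemma powers_times_msize y l N e B : (msize y <= e)%N ->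
  (forall x, x \in l -> msize x <= B)%N ->
  forall x, x \in powers_times y l N -> (msize x <= N * e + B)%N.
Proof.
move=> ye lB; elim: N => //= N IH x; rewrite mem_cat => /orP [/lB|].
  by move=> H; apply: leq_trans H (leq_addl _ _).
case/mapP => z /IH zB ->.
have [->|y0] := eqVneq y 0; first by rewrite mul0r msize0.
have [->|z0] := eqVneq z 0; first by rewrite mulr0 msize0.
by rewrite msizeM //; apply: leq_trans (leq_pred _) _; rewrite mulSn -addnA leq_add.
Qed.

Lemma free_mod_size l B : free_mod (@zero_ideal K n) l ->
  (forall x, x \in l -> msize x <= B.+1)%N -> (size l <= B.+1 ^ n)%N.
Proof.
move=> fl lB; pose T : finType := 'X_{1..n < B.+1}.
pose A : 'M[K]_(size l, #|T|) := \matrix_(i, j) (l`_i)@_(val (enum_val j)).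
have : row_free A.
  apply: inj_row_free => v vA; apply/rowP => i; rewrite mxE.
  have := fl (fun k => oapp (v 0) 0 (insub k)) _ i (ltn_ord i).
  rewrite valK; apply; apply/mpolyP => m; rewrite mcoeff0 raddf_sum /=.
  case: (ltnP (mdeg m) B.+1) => [lt|ge].
    have /rowP/(_ (enum_rank (BMultinom lt))) := vA; rewrite !mxE => E.
    rewrite -[RHS]E; apply: eq_bigr => k _.
    by rewrite mcoeffZ valK mxE enum_rankK.
  rewrite big1 // => k _; rewrite mcoeffZ (_ : _@_m = 0) ?mulr0 //.
  apply/memN_msupp_eq0/msize_mdeg_ge/(leq_trans _ ge).
  by apply: lB; apply: mem_nth.
move=> /eqP <-; apply: leq_trans (rank_leq_col A) _.
pose f (m : T) : {ffun 'I_n -> 'I_B.+1} := [ffun i => inord (val m i)].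
have bnd (m : T) i : (val m i < B.+1)%N.
  by apply: leq_ltn_trans (bmdeg m); rewrite mdegE (bigD1 i) //= leq_addr.
have finj : injective f.
  move=> m1 m2 /ffunP E; apply/val_inj/mnmP => i.
  by have := congr1 val (E i); rewrite !ffunE /= !inordK ?bnd.
by rewrite (leq_trans (leq_card f finj)) // card_ffun !card_ord.
Qed.

(** Choose [y i] in [c i.+1] outside [c i]. Descending the chain, the products of powers below [N]
    of the [y i] give [N ^ L] polynomials independent over [K], of degree at most linear in [N];
    there is room for only [O(N^n)] of them. *)
Lemma prime_chain_le (c : nat -> S -> Prop) L : prime_chain c L -> (L <= n)%N.
Proof.
case=> cP cs; rewrite leqNgt; apply/negP => nL.
have ex k : (k <= L)%N -> exists (y : nat -> S) e, forall i, (i < k)%N ->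
    [/\ c i.+1 (y i), ~ c i (y i) & (msize (y i) <= e)%N].
  elim: k => [|k IH] kL; first by exists (fun=> 0), 0%N.
  have [y [e Hy]] := IH (ltnW kL); have [_ [z [z1 z2]]] := cs k kL.
  exists (fun i => if i == k then z else y i), (maxn e (msize z)) => i.
  rewrite ltnS leq_eqVlt; case: eqP => [-> _|_ /= /Hy [H1 H2 H3]].
    by split; rewrite ?leq_maxr.
  by split=> //; rewrite leq_max H3.
have [y [e Hy]] := ex L (leqnn L).
have fr N k : (k <= L)%N -> exists l, [/\ size l = (N ^ k)%N,
    free_mod (c (L - k)%N) l & forall x, x \in l -> (msize x <= k * (N * e) + 1)%N].
  elim: k => [|k IH] kL.
    exists [:: 1]; split=> //; last by move=> x; rewrite inE => /eqP ->; rewrite msize1.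
    rewrite subn0 => a; have [[_ _ M] nL1 _] := cP L (leqnn L).
    rewrite big_ord1 /= => H i; rewrite ltnS leqn0 => /eqP ->.
    apply/eqP; apply: contraT => a0; case: nL1.
    rewrite -[1]scale1r -(mulVf a0) -scalerA -mul_mpolyC; exact: M.
  have [l [szl fl lB]] := IH (ltnW kL).
  exists (powers_times (y (L - k.+1)%N) l N); rewrite size_powers_times szl expnS.
  have lt : (L - k.+1 < L)%N by lia.
  have [H1 H2 H3] := Hy _ lt; have E : (L - k.+1).+1 = (L - k)%N by lia.
  have [Hs _] := cs _ lt; rewrite E in H1 Hs.
  split=> //.
    apply: powers_times_free Hs H1 H2 fl; first by apply: cP; lia.
    by case: (cP (L - k)%N); first lia.
  by move=> x /(powers_times_msize H3 lB); lia.
(* For [n < L] this gives [(L * N * e + 1)^n <= N^n * (L * e + 1)^n < N^(n+1) <= N^L]. *)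
pose N := ((L * e).+1 ^ n).+1.
have [l [szl fl lB]] := fr N L (leqnn L).
have fl0 : free_mod (@zero_ideal K n) l.
  move=> a /= E; apply: fl; rewrite E subnn.
  by have [[H _ _] _ _] := cP 0%N (leq0n L).
have := free_mod_size (B := (L * (N * e))%N) fl0; rewrite szl.
have lB' x : x \in l -> (msize x <= (L * (N * e)).+1)%N by move/lB; rewrite addn1.
move/(_ lB'); apply/negP; rewrite -ltnNge.
have N0 : (0 < N)%N by [].
apply: (@leq_ltn_trans ((N * (L * e).+1) ^ n)%N).
  by case: (n) => // k; rewrite leq_exp2r //; lia.
rewrite expnMn; apply: (@leq_trans (N ^ n.+1)%N); last by rewrite leq_pexp2l.
by rewrite expnSr ltn_pmul2l ?expn_gt0 // ltnS.
Qed.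

Definition origin : S -> Prop := fun p => p.@[fun=> 0] = 0.

Definition coord_prime (k : nat) : S -> Prop := fun p =>
  p \mPo [tuple if (val i < k)%N then 0 else 'X_i | i < n] = 0.

Lemma ker_prime (R : idomainType) (f : {rmorphism S -> R}) : is_prime (fun p => f p = 0).
Proof.
split; [split|by apply/eqP; rewrite rmorph1 oner_eq0|].
- exact: rmorph0.
- by move=> x y Ex Ey; rewrite rmorphD Ex Ey addr0.
- by move=> r x Ex; rewrite rmorphM Ex mulr0.
by move=> x y /eqP; rewrite rmorphM mulf_eq0 => /orP [] /eqP; [left|right].
Qed.

Lemma origin_prime : is_prime origin.
Proof. exact: (ker_prime (meval (fun=> 0))). Qed.

Lemma coord_primeP k : is_prime (coord_prime k).
Proof. exact: (ker_prime (comp_mpoly _)). Qed.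

Lemma comp_mpoly_origin (p : S) : p \mPo [tuple 0 | i < n] = (p.@[fun=> 0])%:MP_[n].
Proof.
have := @mpoly_rmorph_eq _ _ _ (comp_mpoly [tuple 0 | i < n]) (@mpolyC n K \o meval (fun=> 0)).
apply=> [c|i] /=; first by rewrite comp_mpolyC mevalC.
by rewrite comp_mpolyXU -tnth_nth tnth_mktuple mevalXU.
Qed.

Lemma coord_prime_top : coord_prime n = origin.
Proof.
apply: pred_ext => p; rewrite /coord_prime /origin.
have -> : [tuple if (val i < n)%N then 0 else 'X_i | i < n] = [tuple 0 | i < n] :> n.-tuple S.
  by apply: eq_from_tnth => i; rewrite !tnth_mktuple ltn_ord.
rewrite comp_mpoly_origin; split=> [/eqP|->]; last by rewrite mpolyC0.
by rewrite mpolyC_eq0 => /eqP.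
Qed.

Lemma ht_ge_origin : ht_ge origin n.
Proof.
exists coord_prime; rewrite coord_prime_top; split=> //; split=> i.
  by move=> _; apply: coord_primeP.
move=> lt; split=> [p Hp|].
  rewrite /coord_prime; set lq' := [tuple _ | _ < n].
  have -> : lq' = [tuple (tnth [tuple if (val j < i)%N then 0 else 'X_j | j < n] j) \mPo lq' | j < n].
    apply: eq_from_tnth => j; rewrite !tnth_mktuple.
    case: (ltnP j i) => [lj|le].
      by rewrite comp_mpoly0 ltnS (ltnW lj).
    by rewrite comp_mpolyXU -tnth_nth tnth_mktuple.
  have := @mpoly_rmorph_eq _ _ _ (comp_mpoly lq' \o comp_mpoly [tuple if (val j < i)%N then 0 else 'X_j | j < n])
    (comp_mpoly [tuple (tnth [tuple if (val j < i)%N then 0 else 'X_j | j < n] j) \mPo lq' | j < n]).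
  move=> <-; [by rewrite /= Hp comp_mpoly0 | move=> c | move=> j] => /=.
    by rewrite !comp_mpolyC.
  by rewrite !comp_mpolyXU -!tnth_nth !tnth_mktuple.
exists 'X_(Ordinal lt); rewrite /coord_prime !comp_mpolyXU -!tnth_nth !tnth_mktuple /=.
rewrite ltnSn ltnn; split=> // /eqP.
by rewrite -msize_poly_eq0 msizeX.
Qed.

Lemma prime_exp P x k : is_prime P -> P (x ^+ k) -> P x.
Proof.
case=> _ P1 pP; elim: k => [|k IH]; first by rewrite expr0.
by rewrite exprS => /pP [].
Qed.

Lemma prime_of_vars P : is_prime P -> (forall i, P 'X_i) -> P = origin.
Proof.
move=> pP PX; have [iP P1 _] := pP.
have H p : P (p - (p.@[fun=> 0])%:MP).
  rewrite -comp_mpoly_origin -{1}(comp_mpoly_id p).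
  by apply: comp_mpoly_congr => // i; rewrite !tnth_mktuple subr0.
apply: pred_ext => p; split=> [Pp|E].
  apply/eqP; apply: contraT => c0; case: P1.
  have := (ideal_sub_congr iP (H p)).1 Pp; rewrite -[_%:MP]mulr1 mul_mpolyC => Pc.
  rewrite -[1]scale1r -(mulVf c0) -scalerA -mul_mpolyC; exact: idealMl.
by apply/(ideal_sub_congr iP (H p)); rewrite E mpolyC0; case: iP.
Qed.

(** Every ['X_i ^+ a.+1] has degree [a + 1], where [I] is everything; so [P] contains all the
    variables. *)
Lemma prime_over_finite I P a : is_ideal I ->
  (forall j, (a < j)%N -> HF I (Posz j) = 0%N) ->
  is_prime P -> subI I P -> P = origin.
Proof.
move=> iI fin pP IP; apply: prime_of_vars => // i.
apply: (@prime_exp _ _ a.+1) => //; apply: IP.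
apply: (HF0_in (d := a.+1) (ideal_lin iI)); first exact: fin.
by rewrite mpolyXn dhomogX; apply/eqP; rewrite -[RHS]mul1n -(mdeg1 i) -mdegMn.
Qed.

Lemma add_gens_origin s : homog_seq s -> subI (add_gens (@zero_ideal K n) s) origin.
Proof.
move=> hs p; apply: add_gens_min; first by case: origin_prime.
  by move=> q ->; rewrite /origin meval0.
move=> x /hs [d d0 hx]; apply/eqP; apply: contraT => nx.
have := comp_mpoly_scale (fun=> 0) (0 : S) hx.
have -> : [tuple (fun=> 0 : K) i *: (0 : S) | i < n] = [tuple 0 | i < n].
  by apply: eq_from_tnth => i; rewrite !tnth_mktuple scaler0.
rewrite comp_mpoly_origin expr0n eqn0Ngt d0 scaler0 => /eqP.
by rewrite mpolyC_eq0 (negbTE nx).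
Qed.

Lemma height_finite I a : is_ideal I -> subI I origin ->
  (forall j, (a < j)%N -> HF I (Posz j) = 0%N) -> height_eq I n.
Proof.
move=> iI Io fin; split=> [P pP IP|].
  by rewrite (prime_over_finite iI fin pP IP); apply: ht_ge_origin.
exists origin; split=> //; first exact: origin_prime.
by case=> c [/prime_chain_le]; rewrite ltnn.
Qed.

Lemma artinian_finite I a : is_ideal I -> subI I origin ->
  (forall j, (a < j)%N -> HF I (Posz j) = 0%N) -> artinian I.
Proof.
move=> iI Io fin; split.
  by exists (fun=> origin); split=> //; split=> // i _; apply: origin_prime.
case=> c [[cP cs] Ic]; have [Hs [x [x1 x0]]] := cs 0%N (ltnSn _).
have E0 := prime_over_finite iI fin (cP 0%N isT) Ic.
have E1 : c 1%N = origin by apply: prime_over_finite iI fin (cP 1%N isT) _ => p /Ic /Hs.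
by case: x0; rewrite E0 -E1.
Qed.

End KrullDimension.

(** * Chains of primes below a given prime *)

Section StrippedPrimes.
Variables (K : fieldType) (n : nat).
Local Notation S := {mpoly K[n]}.
Implicit Types (P Q : S -> Prop) (i j : 'I_n).

Definition kill (i : 'I_n) : S -> S :=
  comp_mpoly [tuple if j == i then 0 else 'X_j | j < n].
HB.instance Definition _ i := GRing.RMorphism.copy (kill i)
  (comp_mpoly [tuple if j == i then 0 else 'X_j | j < n]).

Lemma killC i c : kill i c%:MP = c%:MP.
Proof. exact: comp_mpolyC. Qed.

Lemma killX i j : kill i 'X_j = if j == i then 0 else 'X_j.
Proof. by rewrite /kill comp_mpolyXU -tnth_nth tnth_mktuple. Qed.

Opaque uni kill.

(** Absence of ['X_i] is stated as being fixed by a ring morphism, which makes closure under ring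
    operations immediate. *)
Definition free_of i p := kill i p = p.

Lemma uni_kill i p : uni i (kill i p) = (kill i p)%:P.
Proof.
have := @mpoly_rmorph_eq _ _ _ (uni i \o kill i) (polyC \o kill i).
apply=> [c|j] /=; first by rewrite killC uniC.
rewrite killX; case: eqP => [_|/eqP/negbTE ne]; first by rewrite rmorph0 polyC0.
by rewrite uniX ne.
Qed.

Lemma uni_free i p : free_of i p -> uni i p = p%:P.
Proof. by move=> E; rewrite -{1}E uni_kill E. Qed.

Lemma map_kill_uni i j p : map_poly (kill j) (uni i p) = uni i (if i == j then p else kill j p).
Proof.
case: eqP => [<-|/eqP ne].
  have := @mpoly_rmorph_eq _ _ _ (map_poly (kill i) \o uni i) (uni i).
  apply=> [c|k] /=; first by rewrite uniC map_polyC /= killC.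
  rewrite uniX; case: ifP => E; first by rewrite map_polyX.
  by rewrite map_polyC /= killX E.
have := @mpoly_rmorph_eq _ _ _ (map_poly (kill j) \o uni i) (uni i \o kill j).
apply=> [c|k] /=; first by rewrite uniC map_polyC /= !killC uniC.
rewrite killX uniX; case: (eqVneq k j) => [->|nkj].
  by rewrite eq_sym (negbTE ne) map_polyC /= killX eqxx polyC0 rmorph0.
rewrite uniX; case: eqP => E; first by rewrite map_polyX.
by rewrite map_polyC /= killX (negbTE nkj).
Qed.

Lemma free_uni_coef i p k : free_of i (uni i p)`_k.
Proof. by rewrite /free_of -coef_map map_kill_uni eqxx. Qed.

Lemma free_uni_coef_neq i j p k : free_of j p -> free_of j (uni i p)`_k.
Proof.
by rewrite /free_of => E; rewrite -coef_map map_kill_uni; case: eqP; rewrite ?E.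
Qed.

Lemma free_all_const p : (forall i, free_of i p) -> p = (p.@[fun=> 0])%:MP.
Proof.
move=> H; rewrite -comp_mpoly_origin.
suff E (s : seq 'I_n) : p = p \mPo [tuple if j \in s then 0 else 'X_j | j < n].
  rewrite [LHS](E (enum 'I_n)); congr (_ \mPo _).
  by apply: eq_from_tnth => j; rewrite !tnth_mktuple mem_enum.
elim: s => [|i s IH].
  by rewrite -[LHS]comp_mpoly_id; congr (_ \mPo _); apply: eq_from_tnth => j; rewrite !tnth_mktuple.
rewrite {1}IH -{1}(H i).
have := @mpoly_rmorph_eq _ _ _
  (comp_mpoly [tuple if j \in s then 0 else 'X_j : S | j < n] \o kill i)
  (comp_mpoly [tuple if j \in i :: s then 0 else 'X_j | j < n]).
apply=> [c|j] /=; first by rewrite killC !comp_mpolyC.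
rewrite killX comp_mpolyXU -tnth_nth tnth_mktuple inE.
case: eqP => _ /=; first by rewrite comp_mpoly0.
by rewrite comp_mpolyXU -tnth_nth tnth_mktuple.
Qed.

(** The extension to [S] of the contraction of [P] to the polynomial ring without ['X_i]. *)
Definition strip i P : S -> Prop := fun p => forall k, P (uni i p)`_k.

Lemma strip_sub i P p : is_ideal P -> strip i P p -> P p.
Proof.
move=> iP H; rewrite -(horner_uniX i p) horner_coef.
by apply: ideal_sum => // k _; apply: idealMr.
Qed.

Lemma strip_free i P p : is_ideal P -> free_of i p -> P p -> strip i P p.
Proof.
move=> iP fp Pp k; rewrite (uni_free fp) coefC; case: eqP => // _.
by case: iP.
Qed.

(** Gauss's argument: take the least indices at which [u] and [v] have coefficients outside [P], and
    look at the coefficient of the product at their sum. *)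
Lemma prime_poly_coef P (u v : {poly S}) : is_prime P ->
  (forall k, P (u * v)`_k) -> (forall k, P u`_k) \/ (forall k, P v`_k).
Proof.
move=> [iP P1 pP] Huv; apply: NNPP => N.
have least (w : {poly S}) : ~ (forall k, P w`_k) -> exists k, ~ P w`_k /\
    forall l, (l < k)%N -> P w`_l.
  move=> nz; have [k nk] : exists k, ~ P w`_k.
    by apply: NNPP => H; apply: nz => k; apply: NNPP => nk; apply: H; exists k.
  elim/ltn_ind: k nk => k IH nk.
  case: (classic (exists2 l, (l < k)%N & ~ P w`_l)) => [[l lk nl]|H].
    exact: (IH l lk nl).
  exists k; split; first exact: nk.
  by move=> l lk; apply: NNPP => nl; apply: H; exists l.
have [|a [na Ha]] := least u; first by move=> H; apply: N; left.
have [|b [nb Hb]] := least v; first by move=> H; apply: N; right.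
have := Huv (a + b)%N; rewrite coefM.
have la : (a < (a + b).+1)%N by rewrite ltnS leq_addr.
rewrite (bigD1 (Ordinal la)) // => H.
have Pt : P (\sum_(k < (a + b).+1 | k != Ordinal la) u`_k * v`_(a + b - k)).
  apply: ideal_sum => // k; rewrite -val_eqE => ne.
  case: (ltnP k a) => [lt|ge]; first by apply: idealMr => //; apply: Ha.
  apply: idealMl => //; apply: Hb; move/eqP: ne => /= ne.
  by move: (ltn_ord k) => /=; lia.
have {H} := idealB iP H Pt; rewrite addrK.
have -> : (a + b - Ordinal la)%N = b by rewrite /= addKn.
by move=> /pP [].
Qed.

Lemma strip_prime i P : is_prime P -> is_prime (strip i P).
Proof.
move=> pP'; have [iP P1 pP] := pP'; have [P0 _ _] := iP.
split; [split| |].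
- by move=> k; rewrite rmorph0 coef0.
- move=> x y Hx Hy k; rewrite (rmorphD (uni i)) coefD.
  exact: idealD (Hx k) (Hy k).
- move=> r x Hx k; rewrite rmorphM coefM; apply: ideal_sum => // j _.
  exact: idealMl.
- by move/(_ 0%N); rewrite rmorph1 coef1 eqxx.
move=> x y Hxy; apply: (prime_poly_coef pP') => k.
by rewrite -(rmorphM (uni i)); apply: Hxy.
Qed.

Lemma ht_ge_le P L L' : ht_ge P L -> (L' <= L)%N -> ht_ge P L'.
Proof.
case=> c [[cP cs] cL] le; exists (fun k : nat => c (L - L' + k)%N).
rewrite subnK //; split=> //; split=> k le'; first by apply: cP; lia.
by rewrite addnS; apply: cs; lia.
Qed.

(** Each variable of [s] either makes the stripped prime strictly smaller and lengthens the chain,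
    or leaves it unchanged and enters [T]; hence [L + size T = size s]. Once all variables are
    stripped the ideal is zero, and the last clause says that [T] is independent modulo [P]. *)
Lemma strip_chain P (s : seq 'I_n) : is_prime P -> uniq s ->
  exists (L : nat) (T : seq 'I_n) (c : nat -> S -> Prop),
  [/\ prime_chain c L, c L = P, c 0%N = foldr strip P s,
      (L + size T)%N = size s & uniq T /\ {subset T <= s}] /\
  forall p, P p -> (forall i, i \in s -> i \notin T -> free_of i p) -> foldr strip P s p.
Proof.
move=> pP; elim: s => [_|i s IH] /=.
  exists 0%N, [::], (fun=> P); split=> //; split=> //; split=> // j.
case/andP => ins /IH [L [T [c [[[cP cs] cL c0 sz [uT Ts]] H]]]].
have [iR _ _] : is_prime (foldr strip P s) by rewrite -c0; apply: cP.
case: (classic (forall p, foldr strip P s p -> strip i (foldr strip P s) p)) => E.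
  have EE : strip i (foldr strip P s) = foldr strip P s.
    by apply: pred_ext => p; split=> [|/E //]; apply: strip_sub.
  exists L, (i :: T), c; rewrite EE; split; first split=> //=.
    by rewrite addnS sz.
  split; first by rewrite uT andbT; apply: contra ins => /Ts.
    by move=> j; rewrite !inE => /orP [->|/Ts ->]; rewrite ?orbT.
  move=> p Pp fp; apply: H => // j js nj; apply: fp; first by rewrite inE js orbT.
  by rewrite inE negb_or nj andbT; apply: contraNneq ins => <-.
exists L.+1, T, (fun k => if k is k'.+1 then c k' else strip i (foldr strip P s)).
split; first split=> //=.
- split=> [[|k] le|[|k] le] /=.
  + by apply: strip_prime; rewrite -c0; apply: cP.
  + exact: cP.
  + rewrite c0; split; first by move=> p; apply: strip_sub.
    apply: NNPP => N; apply: E => p Hp; apply: NNPP => np; apply: N; by exists p.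
  + exact: cs.
- by rewrite addSn sz.
- by split=> // j /Ts; rewrite inE => ->; rewrite orbT.
move=> p Pp fp; apply: strip_free => //.
  by apply: fp; [rewrite inE eqxx | apply: contra ins => /Ts].
by apply: H => // j js; apply: fp; rewrite inE js orbT.
Qed.

(** Taking leading coefficients in the variables of [s] in turn stays nonzero, stays inside the less
    stripped ideals, and removes these variables for good. *)
Lemma foldr_strip_free P (s : seq 'I_n) p : foldr strip P s p -> p != 0 ->
  exists q, [/\ q != 0, P q, (forall i, i \in s -> free_of i q) &
    forall i, free_of i p -> free_of i q].
Proof.
elim: s p => [|i s IH] p /= Hp p0; first by exists p.
have u0 : uni i p != 0 by rewrite -[0](raddf0 (uni i)) (inj_eq (@uni_inj _ _ i)).
have [|q [q0 Pq fs fp]] := IH (lead_coef (uni i p)) (Hp _); first by rewrite lead_coef_eq0.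
exists q; split=> // [j|j fj]; last exact/fp/free_uni_coef_neq.
by rewrite inE => /predU1P [->|/fs //]; apply/fp/free_uni_coef.
Qed.

Lemma foldr_strip_enum P p : is_prime P -> foldr strip P (enum 'I_n) p -> p = 0.
Proof.
move=> [iP P1 _] Hp; apply/eqP; apply: contraT => /(foldr_strip_free Hp).
case=> q [q0 Pq fq _]; case: P1.
have Eq : q = (q.@[fun=> 0])%:MP by apply: free_all_const => i; apply: fq; rewrite mem_enum.
have c0 : q.@[fun=> 0] != 0 by apply: contraNneq q0 => E; rewrite Eq E mpolyC0.
rewrite -[1]scale1r -(mulVf c0) -scalerA -[_ *: 1]mul_mpolyC mulr1 -Eq -mul_mpolyC.
exact: idealMl.
Qed.

(** The contraction of [P] to [K[T]] is zero: the variables of [T] are algebraically independent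
    modulo [P]. *)
Definition indep_vars P (T : {set 'I_n}) :=
  forall p, P p -> (forall i, i \notin T -> free_of i p) -> p = 0.

Lemma height_indep_vars P h : is_prime P -> ~ ht_ge P h.+1 ->
  exists T, indep_vars P T /\ (n - h <= #|T|)%N.
Proof.
move=> pP nh; have [L [T [c [[ch cL c0 sz [uT Ts]] H]]]] := strip_chain pP (enum_uniq 'I_n).
exists [set i in T]; split.
  move=> p Pp fp; apply: (foldr_strip_enum pP); apply: H => // i _ nT.
  by apply: fp; rewrite inE.
have LP : ht_ge P L by exists c.
have Lh : (L <= h)%N by rewrite leqNgt; apply/negP => lt; apply: nh; apply: ht_ge_le LP lt.
rewrite cardsE (card_uniqP uT).
have arith (L' t m : nat) : (L' + t = m -> L' <= h -> m - h <= t)%N by lia.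
by apply: arith Lh; rewrite sz size_enum_ord.
Qed.

End StrippedPrimes.

(** * Chains of primes above a given prime *)

Lemma det_congr (K : fieldType) n (J : {mpoly K[n]} -> Prop) m (A B : 'M[{mpoly K[n]}]_m) :
  is_ideal J -> (forall i j, J (A i j - B i j)) -> J (\det A - \det B).
Proof.
move=> iJ H; rewrite /determinant -sumrB; apply: ideal_sum => // s _.
rewrite -mulrBr; apply: idealMl => //.
have JM a b c e : J (a - b) -> J (c - e) -> J (c * a - e * b).
  move=> Jab Jce; rewrite (_ : _ - _ = a * (c - e) + e * (a - b)); last by ring.
  by apply: idealD => //; apply: idealMl.
elim/big_rec2: _ => [|i a b _ Jab]; first by rewrite subrr; case: iJ.
exact: JM.
Qed.

(* a maximal ideal among those that contain [Q] and avoid [U] *)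
Lemma prime_avoiding (K : fieldType) n (Q U : {mpoly K[n]} -> Prop) :
  is_ideal Q -> U 1 -> (forall u v, U u -> U v -> U (u * v)) ->
  (forall u, Q u -> ~ U u) ->
  exists P, [/\ is_prime P, subI Q P & forall u, P u -> ~ U u].
Proof.
move=> iQ U1 UM QU.
pose good (A : {mpoly K[n]} -> Prop) := [/\ is_ideal A, subI Q A & forall u, A u -> ~ U u].
pose Pr (A : {mpoly K[n]} -> Prop) := (forall x, ~ A x) \/ good A.
have gQ : good Q by split.
have [|A [PA mA]] := @classical_sets.Zorn_bigcup _ Pr.
  move=> F FP Ft; case: (classic (exists B, F B /\ exists x, B x)) => [[B0 [FB0 [x0 Bx0]]]|N].
    have gd B x : F B -> B x -> good B by move=> /FP [/(_ x)|].
    have [iB0 QB0 _] := gd _ _ FB0 Bx0.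
    right; split; [split| |].
    - by exists B0 => //; case: iB0.
    - move=> x y [B FB Bx] [C FC Cy].
      case: (Ft B C FB FC) => sub.
        by exists C => //; have [iC _ _] := gd _ _ FC Cy; apply: idealD => //; apply: sub.
      by exists B => //; have [iB _ _] := gd _ _ FB Bx; apply: idealD => //; apply: sub.
    - by move=> r x [B FB Bx]; exists B => //; have [iB _ _] := gd _ _ FB Bx; apply: idealMl.
    - by move=> q /QB0 Bq; exists B0.
    - by move=> u [B FB Bu]; have [_ _] := gd _ _ FB Bu; apply.
  by left=> x [B FB Bx]; apply: N; exists B; split=> //; exists x.
case: PA => [A0|[iA QA AU]].
  case: (mA Q); last by right.
  split; first by move=> x /A0.
  by move=> H; have [Q0 _ _] := iQ; exact: (A0 0 (H _ Q0)).
exists A; split=> //; split=> //; first by move/AU.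
move=> x y Axy; apply: NNPP => N.
(* By maximality any proper enlargement of [A] meets [U]. Two such elements, from [A + (x)] and
   [A + (y)], have their product in [U] and, as [x * y] is in [A], also in [A]. *)
have ext z : ~ A z -> exists u, add_gen A z u /\ U u.
  move=> nz; apply: NNPP => N2; case: (mA (add_gen A z)).
    split; first by move=> w; apply: sub_add_gen.
    by move=> H; apply: nz; apply: H; apply: mem_add_gen.
  right; split; first exact: add_gen_ideal.
    by move=> q /QA; apply: sub_add_gen.
  by move=> u zu Uu; apply: N2; exists u.
have [|_ [[a [r [Aa ->]]] U1']] := ext x; first by move=> H; apply: N; left.
have [|_ [[b [q [Ab ->]]] U2']] := ext y; first by move=> H; apply: N; right.
apply: (AU _ _ (UM _ _ U1' U2')).
rewrite (_ : _ * _ = (b + q * y) * a + r * x * b + r * q * (x * y)); last by ring.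
by do 2?[apply: idealD => //]; apply: idealMl.
Qed.

Section PrimeAbove.
Variables (K : fieldType) (n : nat).
Local Notation S := {mpoly K[n]}.
Variables (P : S -> Prop) (T : {set 'I_n}) (t : 'I_n).
Hypotheses (pP : is_prime P) (indT : indep_vars P T).
Hypothesis maxT : forall i, i \notin T -> ~ indep_vars P (i |: T).
Hypothesis tT : t \in T.

Let iP : is_ideal P. Proof. by case: pP. Qed.

Definition in_vars (p : S) := forall i, i \notin T -> free_of i p.

Lemma in_vars1 : in_vars 1. Proof. by move=> i _; apply: rmorph1. Qed.
Lemma in_vars0 : in_vars 0. Proof. by move=> i _; apply: rmorph0. Qed.
Lemma in_varsC c : in_vars c%:MP. Proof. by move=> i _; apply: killC. Qed.
Lemma in_varsD p q : in_vars p -> in_vars q -> in_vars (p + q).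
Proof. by move=> hp hq i iT; rewrite /free_of (rmorphD (kill i)) /= hp ?hq. Qed.
Lemma in_varsN p : in_vars p -> in_vars (- p).
Proof. by move=> hp i iT; rewrite /free_of (rmorphN (kill i)) /= hp. Qed.
Lemma in_varsM p q : in_vars p -> in_vars q -> in_vars (p * q).
Proof. by move=> hp hq i iT; rewrite /free_of (rmorphM (kill i)) /= hp ?hq. Qed.
Lemma in_varsX i : i \in T -> in_vars 'X_i.
Proof.
move=> iT j jT; rewrite /free_of killX; case: eqP => // E.
by case/negP: jT; rewrite -E.
Qed.
Lemma in_varsXn p k : in_vars p -> in_vars (p ^+ k).
Proof. by move=> hp i iT; rewrite /free_of (rmorphXn (kill i)) /= hp. Qed.
Lemma in_vars_sum (I : Type) (r : seq I) (Q : pred I) (F : I -> S) :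
  (forall i, Q i -> in_vars (F i)) -> in_vars (\sum_(i <- r | Q i) F i).
Proof. by move=> H; apply: big_ind => //; [apply: in_vars0 | apply: in_varsD]. Qed.
Lemma in_vars_prod (I : Type) (r : seq I) (Q : pred I) (F : I -> S) :
  (forall i, Q i -> in_vars (F i)) -> in_vars (\prod_(i <- r | Q i) F i).
Proof. by move=> H; apply: big_ind => //; [apply: in_vars1 | apply: in_varsM]. Qed.
Lemma in_vars_det m (A : 'M[S]_m) : (forall i j, in_vars (A i j)) -> in_vars (\det A).
Proof.
move=> H; apply: in_vars_sum => s _; apply: in_varsM.
  by apply: in_varsXn; apply: in_varsN; apply: in_vars1.
by apply: in_vars_prod.
Qed.

(** By maximality of [T] some nonzero element of [P] involves only [T] and ['X_i]; its degree in
    ['X_i] is positive since [P] meets [K[T]] in zero. The condition on [i] stands under the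
    quantifier so that one family [q] can be chosen for all [i]. *)
Lemma algebraic_relation i : exists q : {poly S}, i \notin T ->
  [/\ P q.['X_i], forall k, in_vars q`_k, q != 0 & (1 < size q)%N].
Proof.
case: (boolP (i \in T)) => iT; first by exists 0.
have [q [Pq fq q0]] : exists q, [/\ P q, (forall j, j \notin i |: T -> free_of j q) & q != 0].
  apply: NNPP => N; apply: (maxT iT) => q Pq fq; apply/eqP; apply: contraT => q0.
  by case: N; exists q.
have u0 : uni i q != 0 by rewrite -[0](raddf0 (uni i)) (inj_eq (@uni_inj _ _ i)).
exists (uni i q) => _; split=> //; first by rewrite horner_uniX.
  move=> k j jT; case: (eqVneq i j) => [<-|ne]; first exact: free_uni_coef.
  by apply: free_uni_coef_neq; apply: fq; rewrite !inE negb_or eq_sym ne.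
rewrite ltnNge; apply/negP => sz; case/eqP: q0; apply: indT => // j jT.
have E : uni i q = ((uni i q)`_0)%:P by apply: size1_polyC.
have Eq : q = (uni i q)`_0 by rewrite -[LHS](horner_uniX i) {1}E hornerC.
case: (eqVneq i j) => [<-|ne]; first by rewrite Eq; apply: free_uni_coef.
by apply: fq; rewrite !inE negb_or eq_sym ne.
Qed.

Section Module.
Variable q : 'I_n -> {poly S}.
Hypothesis qP : forall i, i \notin T ->
  [/\ P (q i).['X_i], forall k, in_vars (q i)`_k, q i != 0 & (1 < size (q i))%N].
Let D i := (size (q i)).-1.
(** Once [g] is inverted, all variables outside [T] are integral over [K[T]] modulo [P]. *)
Let g : S := \prod_(i | i \notin T) lead_coef (q i).

Lemma in_vars_g : in_vars g.
Proof. by apply: in_vars_prod => i /qP [_ H _ _]; rewrite lead_coefE; apply: H. Qed.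

Lemma g_neq0 : g != 0.
Proof. by apply/prodf_neq0 => i /qP [_ _ q0 _]; rewrite lead_coef_eq0. Qed.

(* The [K[T]]-submodule of [S] spanned by [P] and the monomials in the variables [s]
   whose exponent in each variable [i] is less than [D i]. *)
Fixpoint mod_span (s : seq 'I_n) : S -> Prop :=
  if s is i :: s' then fun f => exists c : nat -> S,
    (forall k, mod_span s' (c k)) /\ f = \sum_(k < D i) 'X_i ^+ k * c k
  else fun f => exists a, in_vars a /\ P (f - a).

Definition closed_mod (M : S -> Prop) :=
  [/\ forall x y, M x -> M y -> M (x + y), forall a x, in_vars a -> M x -> M (a * x) & subI P M].

Lemma closed_mod_sum M (I : Type) (r : seq I) (Q : pred I) (F : I -> S) : closed_mod M ->
  (forall i, Q i -> M (F i)) -> M (\sum_(i <- r | Q i) F i).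
Proof. by case=> MD _ PM H; apply: big_ind => //; apply: PM; case: iP. Qed.

Lemma mod_span_term i s (k : nat) f : closed_mod (mod_span s) -> (k < D i)%N ->
  mod_span s f -> mod_span (i :: s) ('X_i ^+ k * f).
Proof.
move=> [_ _ PM] kD Mf; exists (fun l => if l == k then f else 0); split.
  by move=> l; case: eqP => // _; apply: PM; case: iP.
rewrite (bigD1 (Ordinal kD)) //= eqxx big1 ?addr0 // => l.
by rewrite -val_eqE /= => /negbTE ->; rewrite mulr0.
Qed.

Lemma mod_span_closed s : {subset s <= ~: T} -> closed_mod (mod_span s).
Proof.
elim: s => [_|i s IH sT].
  split.
  - move=> x y [a [ha Pa]] [b [hb Pb]]; exists (a + b); split; first exact: in_varsD.
    by rewrite opprD addrACA; apply: idealD.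
  - move=> a x ha [b [hb Pb]]; exists (a * b); split; first exact: in_varsM.
    by rewrite -mulrBr; apply: idealMl.
  - by move=> p Pp; exists 0; split; [apply: in_vars0 | rewrite subr0].
have cs : closed_mod (mod_span s) by apply: IH => j js; apply: sT; rewrite inE js orbT.
have iT : i \notin T by have := sT i (mem_head _ _); rewrite inE.
have [_ _ _ sz] := qP iT; have D0 : (0 < D i)%N by rewrite /D; lia.
have [MD MA PM] := cs; split.
- move=> _ _ [c [hc ->]] [e [he ->]]; exists (fun k => c k + e k); split.
    by move=> k; exact: MD (hc k) (he k).
  by rewrite -big_split; apply: eq_bigr => k _; rewrite mulrDr.
- move=> a _ ha [c [hc ->]]; exists (fun k => a * c k); split.
    by move=> k; exact: MA ha (hc k).
  by rewrite mulr_sumr; apply: eq_bigr => k _; rewrite mulrCA.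
- by move=> p /PM Mp; have := mod_span_term cs D0 Mp; rewrite mul1r.
Qed.

(** When the exponent of ['X_j] reaches [D j], the factor [lead_coef (q j)] of [g] allows the
    relation [q j] to replace that power by lower ones modulo [P]. *)
Lemma mod_span_stable s j f : {subset s <= ~: T} -> (j \in T) || (j \in s) ->
  mod_span s f -> mod_span s (g * 'X_j * f).
Proof.
case: (boolP (j \in T)) => [jT sT _|jT] /=.
  have [_ MA _] := mod_span_closed sT; apply: MA.
  by apply: in_varsM; [apply: in_vars_g | apply: in_varsX].
elim: s f => [|i s IH] f sT //.
have sT' : {subset s <= ~: T} by move=> k ks; apply: sT; rewrite inE ks orbT.
have cs := mod_span_closed sT'; have cs' := mod_span_closed sT.
have [_ MA PM] := cs; rewrite inE; case: (eqVneq j i) => [E _|ne /= js]; last first.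
  case=> c [hc ->]; exists (fun k => g * 'X_j * c k); split; first by move=> k; apply: IH.
  by rewrite mulr_sumr; apply: eq_bigr => k _; rewrite mulrCA.
case=> c [hc ->]; rewrite mulr_sumr; apply: closed_mod_sum => // k _.
case: (ltnP k.+1 (D i)) => [lt|ge].
  rewrite (_ : _ * _ = 'X_i ^+ k.+1 * (g * c k)).
    by apply: mod_span_term => //; exact: MA in_vars_g (hc k).
  by rewrite E exprS; ring.
have Ek : k.+1 = D i by apply/eqP; rewrite eqn_leq ltn_ord.
have iT : i \notin T by rewrite -E.
have [Pq Aq q0 sz] := qP iT.
pose g' := \prod_(l | (l \notin T) && (l != i)) lead_coef (q l).
have Eg : g = lead_coef (q i) * g' by rewrite /g (bigD1 i).
have Ag' : in_vars g'.
  by apply: in_vars_prod => l /andP [/qP [_ H _ _] _]; rewrite lead_coefE; apply: H.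
have [MD MA' PM'] := cs'.
have Eh : (q i).['X_i] = \sum_(l < D i) (q i)`_l * 'X_i ^+ l + lead_coef (q i) * 'X_i ^+ (D i).
  have le : (size (q i) <= (D i).+1)%N by rewrite /D; lia.
  by rewrite (horner_coef_wide _ le) big_ord_recr lead_coefE.
have -> : g * 'X_j * ('X_i ^+ k * c k) = g' * c k * (q i).['X_i]
    + (-1) * \sum_(l < D i) 'X_i ^+ l * (g' * (q i)`_l * c k).
  have -> : \sum_(l < D i) 'X_i ^+ l * (g' * (q i)`_l * c k)
      = g' * c k * \sum_(l < D i) (q i)`_l * 'X_i ^+ l.
    by rewrite mulr_sumr; apply: eq_bigr => l _; ring.
  have EX : 'X_i ^+ D i = 'X_i * 'X_i ^+ k :> S by rewrite -exprS Ek.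
  by rewrite Eh Eg E EX; ring.
apply: MD; first by apply: PM'; apply: idealMl.
apply: MA'; first by apply: in_varsN; apply: in_vars1.
apply: closed_mod_sum => // l _; apply: mod_span_term => //.
exact: MA (in_varsM Ag' (Aq l)) (hc k).
Qed.

Definition spans (l : seq S) (f : S) := exists c : nat -> S,
  (forall k, in_vars (c k)) /\ P (f - \sum_(i < size l) c i * l`_i).

Lemma spans_cat l1 l2 f1 f2 : spans l1 f1 -> spans l2 f2 -> spans (l1 ++ l2) (f1 + f2).
Proof.
move=> [c [hc Pc]] [e [he Pe]].
exists (fun k => if (k < size l1)%N then c k else e (k - size l1)%N); split.
  by move=> k; case: ifP.
rewrite size_cat big_split_ord /=.
rewrite (eq_bigr (fun i : 'I_(size l1) => c i * l1`_i)); last first.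
  by move=> i _; rewrite nth_cat ltn_ord.
rewrite [X in _ - (_ + X)](eq_bigr (fun i : 'I_(size l2) => e i * l2`_i)); last first.
  by move=> i _; rewrite nth_cat ltnNge leq_addr /= addKn.
by rewrite opprD addrACA; apply: idealD.
Qed.

Lemma spans_mul y l f : spans l f -> spans [seq y * x | x <- l] (y * f).
Proof.
case=> c [hc Pc]; exists c; split=> //; rewrite size_map.
rewrite (eq_bigr (fun i : 'I_(size l) => y * (c i * l`_i))); last first.
  by move=> i _; rewrite (nth_map 0) // mulrCA.
by rewrite -mulr_sumr -mulrBr; apply: idealMl.
Qed.

(** The generator 1 is kept in first place: in the determinant trick it is the entry from which
    [\det N] itself is seen to lie in [P]. *)
Lemma mod_span_generated s : {subset s <= ~: T} -> exists l : seq S,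
  [/\ (0 < size l)%N, l`_0 = 1, (forall x, x \in l -> mod_span s x)
    & forall f, mod_span s f -> spans l f].
Proof.
elim: s => [_|i s IH sT].
  exists [:: 1]; split=> //.
    move=> x; rewrite inE => /eqP ->; exists 1; rewrite subrr; split; first exact: in_vars1.
    by case: iP.
  move=> f [a [ha Pa]]; exists (fun=> a); split=> //.
  by rewrite big_ord1 mulr1.
have sT' : {subset s <= ~: T} by move=> k ks; apply: sT; rewrite inE ks orbT.
have cs := mod_span_closed sT'.
have [l [l0 l1 lM lS]] := IH sT'.
have iT : i \notin T by have := sT i (mem_head _ _); rewrite inE.
have [_ _ _ sz] := qP iT; have D0 : (0 < D i)%N by rewrite /D; lia.
exists (powers_times 'X_i l (D i)); split.
- by rewrite size_powers_times muln_gt0 D0.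
- by case: (D i) D0 => // N _ /=; rewrite nth_cat l0.
- have H N x : x \in powers_times 'X_i l N -> exists k z,
      [/\ (k < N)%N, z \in l & x = 'X_i ^+ k * z].
    elim: N x => //= N IHN x; rewrite mem_cat => /orP [xl|].
      by exists 0%N, x; split; rewrite ?mul1r.
    case/mapP => _ /IHN [k [z [kN zl ->]]] ->; exists k.+1, z; split=> //.
    by rewrite exprS mulrA.
  by move=> x /H [k [z [kD /lM Mz ->]]]; apply: mod_span_term.
move=> _ [c [hc ->]]; elim: (D i) c hc => [|N IHN] c hc /=.
  exists (fun=> 0); split; first by move=> _; apply: in_vars0.
  by rewrite !big_ord0 subr0; case: iP.
rewrite big_ord_recl mul1r; apply: spans_cat; first exact/lS/hc.
have := spans_mul 'X_i (IHN (fun k => c k.+1) (fun k => hc k.+1)).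
rewrite mulr_sumr; congr spans; apply: eq_bigr => k _.
by rewrite mulrA -exprS.
Qed.

Let s := enum (~: T).

Let sT : {subset s <= ~: T}. Proof. by move=> i; rewrite mem_enum. Qed.

(** The elements [r] with this property are closed under sums and products and include the constants
    and the variables. *)
Lemma mod_span_multiple r : exists k, forall f, mod_span s f -> mod_span s (g ^+ k * r * f).
Proof.
have [MD MA PM] := mod_span_closed sT.
pose R r := exists k, forall f, mod_span s f -> mod_span s (g ^+ k * r * f).
have RM a b : R a -> R b -> R (a * b).
  move=> [k Hk] [l Hl]; exists (k + l)%N => f Mf.
  rewrite (_ : _ * _ * _ = g ^+ k * a * (g ^+ l * b * f)); last by rewrite exprD; ring.
  by apply: Hk; apply: Hl.
have RD a b : R a -> R b -> R (a + b).
  move=> [k Hk] [l Hl]; exists (k + l)%N => f Mf.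
  rewrite (_ : _ * _ * _ = g ^+ l * (g ^+ k * a * f) + g ^+ k * (g ^+ l * b * f)); last first.
    by rewrite exprD; ring.
  by apply: MD; apply: MA; [exact: in_varsXn in_vars_g | exact: Hk
    | exact: in_varsXn in_vars_g | exact: Hl].
have RC c : R c%:MP by exists 0%N => f Mf; rewrite mul1r; apply: MA => //; apply: in_varsC.
have RX i : R 'X_i.
  exists 1%N => f Mf; rewrite expr1; apply: mod_span_stable => //.
  by rewrite mem_enum inE; case: (i \in T).
rewrite -/(R r) (mpolyE r); apply: (big_ind R) => [||m _]; first by rewrite -mpolyC0.
  exact: RD.
rewrite -mul_mpolyC; apply: (RM) => //; rewrite mpolyXE_id.
apply: (big_ind R) => [||i _]; first by rewrite -mpolyC1.
  exact: RM.
by elim: (m i) => [|k IH]; rewrite ?expr0 ?exprS -?mpolyC1 //; apply: RM.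
Qed.

Lemma size_uni_separator : (1 < size (uni t (1 + g * 'X_t)%R))%N.
Proof.
have ug : uni t g != 0 by rewrite -[0](raddf0 (uni t)) (inj_eq (@uni_inj _ _ t)) g_neq0.
have szg : (1 < size (uni t g * 'X)%R)%N by rewrite size_mulX // ltnS lt0n size_poly_eq0.
rewrite (rmorphD (uni t)) (rmorphM (uni t)) rmorph1 /= uniX eqxx addrC.
by rewrite size_polyDl // size_poly1.
Qed.

(* The determinant trick shows that [s] divides a power of [g u] in [K[T]], whereas
   [s] is coprime to [g] and involves the variable [t]. *)
Lemma avoid_transcendental u : add_gen P (1 + g * 'X_t) u ->
  (forall i, i \notin T :\ t -> free_of i u) -> u = 0.
Proof.
set sg := 1 + g * 'X_t => -[p [r [Pp Eu]]] fu.
have Au : in_vars u by move=> i iT; apply: fu; rewrite !inE (negbTE iT) andbF.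
have Asg : in_vars sg.
  by apply: in_varsD; [exact: in_vars1 | apply: in_varsM; [exact: in_vars_g | exact: in_varsX]].
have [k Hk] := mod_span_multiple r.
have [l [l0 l1 lM lS]] := mod_span_generated sT.
set m := size l in l0.
have /fin_all_exists [c Hc] : forall i : 'I_m, exists c : nat -> S,
    (forall k, in_vars (c k)) /\ P (g ^+ k * r * l`_i - \sum_(j < m) c j * l`_j).
  by move=> i; apply/lS/Hk/lM/mem_nth.
pose C : 'M[S]_m := \matrix_(i, j) c i j.
(* Since [u] is [r * sg] modulo [P], multiplication by [g ^+ k * u] acts on the generators as
   [sg *: C]; so [N] kills [W] modulo [P]. *)
pose N := (g ^+ k * u)%:M - sg *: C.
pose W : 'cV[S]_m := \col_i l`_i.
have NW i : P ((N *m W) i 0).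
  rewrite mulmxBl mul_scalar_mx -scalemxAl !mxE.
  rewrite (_ : _ - _ = g ^+ k * l`_i * p
     + sg * (g ^+ k * r * l`_i - \sum_(j < m) c i j * l`_j)).
    by apply: idealD => //; apply: idealMl => //; case: (Hc i).
  rewrite (eq_bigr (fun j : 'I_m => c i j * l`_j)); last by move=> j _; rewrite !mxE.
  by rewrite Eu; ring.
have detP : P (\det N).
  have := mul_adj_mx N => /(congr1 (fun M => (M *m W) (Ordinal l0) 0)).
  rewrite mul_scalar_mx [in RHS]mxE [W _ _]mxE l1 mulr1 -mulmxA => <-.
  by rewrite mxE; apply: ideal_sum => // j _; apply: idealMl.
have det0 : \det N = 0.
  apply: indT => //; apply: in_vars_det => i j; rewrite !mxE.
  apply: in_varsD.
    case: (i == j); rewrite ?mulr1n ?mulr0n; last exact: in_vars0.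
    by apply: in_varsM => //; apply: in_varsXn in_vars_g.
  by apply: in_varsN; apply: in_varsM => //; case: (Hc i).
pose J := add_gen (@zero_ideal K n) sg.
have iJ : is_ideal J by apply: add_gen_ideal; case: (@zero_homog_ideal K n).
have Jsg : J sg by apply: mem_add_gen; case: (@zero_homog_ideal K n).
have Jgu : J ((g ^+ k * u) ^+ m).
  have := @det_congr K n J m N (g ^+ k * u)%:M iJ.
  rewrite det0 det_scalar sub0r => H; rewrite -[X in J X]opprK.
  apply: idealN => //; apply: H => i j; rewrite !mxE addrAC subrr sub0r.
  by apply: idealN => //; apply: idealMr.
(* [g] is a unit modulo [sg], because [1 = sg - g * 'X_t]. *)
have Jg v : J (g * v) -> J v.
  move=> Jgv; rewrite (_ : v = v * sg - 'X_t * (g * v)); last by rewrite /sg; ring.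
  by apply: idealB => //; apply: idealMl.
have Jgk a v : J (g ^+ a * v) -> J v.
  by elim: a v => [|a IH] v; rewrite ?mul1r // exprS -mulrA => /Jg /IH.
have {Jgu} [_ [b [-> E]]] : J (u ^+ m).
  by apply: (Jgk (k * m)%N); rewrite exprM -exprMn.
apply/eqP; apply: contraT => u0.
have um0 : u ^+ m != 0 by rewrite expf_neq0.
rewrite add0r in E.
have b0 : b != 0 by apply: contraNneq um0 => b0; rewrite E b0 mul0r.
have ft : free_of t (u ^+ m).
  rewrite /free_of (rmorphXn (kill t)); congr (_ ^+ _); apply: fu.
  by rewrite !inE eqxx.
have uinj (v : S) : v != 0 -> uni t v != 0.
  by move=> v0; rewrite -[0](raddf0 (uni t)) (inj_eq (@uni_inj _ _ t)).
have szs : (1 < size (uni t sg))%N := size_uni_separator.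
have us0 : uni t sg != 0 by rewrite -size_poly_eq0 -lt0n ltnW.
(* Degrees in ['X_t] clash: the left side has degree 0, whereas [sg] has positive degree and [b] is
   nonzero. *)
have Eu' : uni t (u ^+ m) = uni t b * uni t sg.
  by rewrite -(rmorphM (uni t)); congr (uni t _).
have Es : size (uni t b * uni t sg)%R = 1%N.
  by rewrite -Eu' (uni_free ft) size_polyC um0.
move: Es; rewrite (size_mul (uinj _ b0) us0).
have sb : (0 < size (uni t b))%N by rewrite lt0n size_poly_eq0 uinj.
have arith (a1 a2 : nat) : (1 < a2 -> 0 < a1 -> (a1 + a2).-1 = 1 -> false)%N by lia.
exact: arith szs sb.
Qed.

End Module.

(** Adjoin [1 + g * 'X_t] to [P]. By [avoid_transcendental] the result meets the polynomials in
    [T :\ t] only in zero, so some prime above it avoids the nonzero ones. The new element is a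
    nonzero polynomial in [T], hence not in [P]. *)
Lemma prime_above : exists P', [/\ is_prime P', ssubI P P' & indep_vars P' (T :\ t)].
Proof.
have [q qP] := fin_all_exists algebraic_relation.
set g : S := \prod_(i | i \notin T) lead_coef (q i).
pose U (u : S) := (forall i, i \notin T :\ t -> free_of i u) /\ u <> 0.
have [||||P' [pP' QP' U']] := @prime_avoiding K n (add_gen P (1 + g * 'X_t)) U.
- exact: add_gen_ideal.
- by split; [move=> i _; apply: rmorph1 | apply/eqP/oner_neq0].
- move=> u v [fu u0] [fv v0]; split; last by apply/eqP; rewrite mulf_neq0 //; apply/eqP.
  by move=> i iT; rewrite /free_of (rmorphM (kill i)) /= fu ?fv.
- by move=> u Qu [fu u0]; apply: u0; apply: avoid_transcendental Qu fu.
exists P'; split=> //; last first.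
  by move=> p Pp fp; apply: NNPP => p0; apply: (U' p).
split; first by move=> p Pp; apply/QP'/sub_add_gen.
exists (1 + g * 'X_t); split; first by apply/QP'/mem_add_gen.
move=> Ps; have [_ nP1 _] := pP.
have E : 1 + g * 'X_t = 0.
  apply: indT => //; apply: in_varsD; first exact: in_vars1.
  by apply: in_varsM; [exact: (in_vars_g qP) | exact: in_varsX].
by have := size_uni_separator qP; rewrite E raddf0 size_poly0.
Qed.

End PrimeAbove.

Lemma dim_ge_indep_vars (K : fieldType) n (P : {mpoly K[n]} -> Prop) (T : {set 'I_n}) m :
  is_prime P -> indep_vars P T -> (m <= #|T|)%N -> dim_ge P m.
Proof.
elim: m P T => [|m IH] P T pP iT mT; first by exists (fun=> P); split=> //; split.
(* [prime_above] asks for a maximal independent set, so [T] is enlarged first; the new prime then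
   costs one variable. *)
have [T' [mT' iT' maxT']] : exists T' : {set 'I_n}, [/\ (m < #|T'|)%N, indep_vars P T' &
    forall i, i \notin T' -> ~ indep_vars P (i |: T')].
  have H k : forall T : {set 'I_n}, (m < #|T|)%N -> (n - #|T| < k)%N -> indep_vars P T ->
      exists T' : {set 'I_n}, [/\ (m < #|T'|)%N, indep_vars P T' &
        forall i, i \notin T' -> ~ indep_vars P (i |: T')].
    elim: k => // k IHk U mU nU iU.
    case: (classic (exists2 i, i \notin U & indep_vars P (i |: U))) => [[i iU' iiU]|N]; last first.
      by exists U; split=> // i ni ii; apply: N; exists i.
    have cU : #|i |: U| = #|U|.+1 by rewrite cardsU1 iU'.
    have le : (#|U|.+1 <= n)%N by rewrite -cU -[X in (_ <= X)%N]card_ord max_card.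
    apply: (IHk (i |: U)) => //; first by rewrite cU ltnS ltnW.
    by rewrite cU; move: #|U| nU le => x; lia.
  exact: (H (n - #|T|).+1 T).
have /card_gt0P [t tT'] : (0 < #|T'|)%N by lia.
have [P' [pP' [PP' sPP'] iP']] := prime_above pP iT' maxT' tT'.
have [|c [[cP cs] Pc]] := IH P' _ pP' iP'; first by rewrite (cardsD1 t) tT' in mT'.
exists (fun k => if k is k'.+1 then c k' else P); split=> //.
split=> [[|k] //= kL|[|k] //= kL]; [exact: cP | | exact: cs].
split; first by move=> x /PP' /Pc.
by have [x [x1 x0]] := sPP'; exists x; split=> //; apply: Pc.
Qed.

Lemma dim_ge_of_height (K : fieldType) n (I P : {mpoly K[n]} -> Prop) h :
  is_prime P -> subI I P -> ~ ht_ge P h.+1 -> dim_ge I (n - h).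
Proof.
move=> pP IP /(height_indep_vars pP) [T [iT le]].
have [c [cc Pc]] := dim_ge_indep_vars pP iT le.
by exists c; split=> // x /IP /Pc.
Qed.

(** * Multiplicities *)

Lemma iter_sumop_bin u c k : (forall j, (u j <= c)%N) ->
  forall j, (iter k sumop u j <= c * 'C(j + k, k))%N.
Proof.
move=> uc; elim: k => [|k IH] j; first by rewrite bin0 muln1.
elim: j => [|j IHj].
  by rewrite /= /sumop big_ord1 add0n binn; have := IH 0%N; rewrite add0n binn.
rewrite [iter _ _ _]/= sumopS -/(iter k.+1 sumop u) addSn binS mulnDr leq_add //.
by have := IH j.+1; rewrite addSnnS.
Qed.

Lemma ffact_le_expn n m : (n ^_ m <= n ^ m)%N.
Proof.
elim: m => [|m IH]; first by rewrite ffactn0.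
by rewrite ffactnSr expnSr leq_mul // leq_subr.
Qed.

(** The estimate [(1 + a/j)^m <= 1 + c/j] with denominators cleared. *)
Lemma expn_shift_bound a m : exists c, forall j, (0 < j)%N ->
  ((j + a) ^ m * j <= j ^ m * (j + c))%N.
Proof.
elim: m => [|m [c IH]]; first by exists 0%N => j _; rewrite addn0.
exists (a + c + a * c)%N => j j0; rewrite expnS -mulnA.
apply: leq_trans (leq_mul (leqnn _) (IH j j0)) _.
rewrite mulnCA expnSr -mulnA leq_mul2l; apply/orP; right.
have : (a * c <= j * (a * c))%N by rewrite leq_pmull.
by rewrite !mulnDl !mulnDr; lia.
Qed.

(** Says [l * (1 + a/j)^m <= l + 1/2] for some large [j]. The other half of the unit gap between
    integers is spent on the limit in [multiplicity_le]. *)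
Lemma growth_eventually l a m N : exists2 j, (N <= j)%N &
  (0 < j)%N /\ (2 * (l * (j + a) ^ m) <= (2 * l + 1) * j ^ m)%N.
Proof.
have [c Hc] := expn_shift_bound a m.
exists (N + 2 * l * c).+1; first by rewrite leqW ?leq_addr.
set j := (N + 2 * l * c).+1; split=> //.
have cj : (2 * l * c <= j)%N by rewrite /j leqW ?leq_addl.
have j0 : (0 < j)%N by [].
move: (j) cj j0 => {}j cj j0; rewrite -(leq_pmul2r (m := j)) //.
have -> : (2 * (l * (j + a) ^ m) * j = 2 * l * ((j + a) ^ m * j))%N by ring.
apply: (@leq_trans (2 * l * (j ^ m * (j + c)))%N); first by rewrite leq_mul2l Hc ?orbT.
have -> : (2 * l * (j ^ m * (j + c)) = 2 * l * (j ^ m * j) + j ^ m * (2 * l * c))%N by ring.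
have -> : ((2 * l + 1) * j ^ m * j = 2 * l * (j ^ m * j) + j ^ m * j)%N by ring.
by rewrite leq_add2l leq_mul2l cj orbT.
Qed.

Lemma dim_ge_le (K : fieldType) n (I : {mpoly K[n]} -> Prop) L L' :
  dim_ge I L -> (L' <= L)%N -> dim_ge I L'.
Proof.
case=> c [[cP cs] Ic] le; exists c; split=> //; split=> i lt.
  by apply: cP; apply: leq_trans lt le.
by apply: cs; apply: leq_trans lt le.
Qed.

Lemma multiplicity_le (K : fieldType) n (I : {mpoly K[n]} -> Prop) k (w : nat -> nat) l e :
  dim_ge I k -> (forall j, (sumop w j <= l)%N) ->
  (forall j, (HF I (Posz j) <= iter k sumop w j)%N) ->
  multiplicity_is I e -> (e <= l)%N.
Proof.
move=> dk wl HFw [dd [[_ nd] lim]].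
have kdd : (k <= dd)%N.
  by rewrite leqNgt; apply/negP => lt; apply: nd; apply: dim_ge_le dk lt.
have [|N HN] := lim (1 / 2%:R); first by rewrite divr_gt0 ?ltr01 ?ltr0n.
have [j Nj [j0 Hj]] := growth_eventually l dd dd N.
have Hs : (\sum_(i < j.+1) HF I (Posz i) <= l * 'C(j + k, k))%N.
  apply: (@leq_trans (iter k.+1 sumop w j)).
    by apply: leq_sum => i _; apply: HFw.
  by rewrite iterSr; apply: iter_sumop_bin.
have Hb : (dd`! * 'C(j + k, k) <= (j + dd) ^ dd)%N.
  apply: leq_trans (ffact_le_expn _ _); rewrite -bin_ffact mulnC leq_mul2r.
  apply/orP; right; rewrite -(bin_sub (leq_addl j k)) -(bin_sub (leq_addl j dd)) !addnK.
  by apply: leq_bin2l; rewrite leq_add2l.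
have {Hs Hb} H : (2 * (dd`! * \sum_(i < j.+1) HF I (Posz i)) <= (2 * l + 1) * j ^ dd)%N.
  apply: leq_trans Hj; rewrite leq_mul2l /=.
  apply: leq_trans (leq_mul (leqnn _) Hs) _.
  by rewrite mulnCA leq_mul2l Hb orbT.
have jd0 : 0 < (j%:R ^+ dd : rat) by rewrite exprn_gt0 // ltr0n.
have := HN j Nj; set s := (\sum_(_ < _) _)%N in H *; rewrite ltr_norml => /andP [lb _].
have xle : (dd`!)%:R * s%:R / j%:R ^+ dd <= l%:R + 1 / 2%:R :> rat.
  rewrite ler_pdivrMr // -(ler_pM2l (_ : 0 < 2%:R)) ?ltr0n //.
  have -> : 2%:R * ((l%:R + 1 / 2%:R) * j%:R ^+ dd) = (2 * l + 1)%:R * j%:R ^+ dd :> rat.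
    by rewrite natrD natrM; field.
  by rewrite -natrX -!natrM ler_nat.
rewrite -ltnS -(ltr_nat rat).
move: lb; rewrite ltrBrDr => lb.
have {lb} : e%:R < l%:R + 1 / 2%:R + 1 / 2%:R :> rat.
  rewrite -(ltrD2l (- (1 / 2%:R))); apply: lt_le_trans lb _.
  by rewrite addrC addrK.
rewrite -addrA -mulrDl (_ : 1 + 1 = 2%:R) ?divff ?pnatr_eq0 // => H1.
by rewrite -natr1.
Qed.

(** In dimension 0 the factorial and the power disappear, and the limit is that of an eventually
    constant sequence of integers. *)
Lemma multiplicity_artinian (K : fieldType) n (I : {mpoly K[n]} -> Prop) a e :
  artinian I -> (forall j, (a < j)%N -> HF I (Posz j) = 0%N) -> multiplicity_is I e ->
  (sumop (fun j => HF I (Posz j)) a <= e)%N.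
Proof.
move=> [_ nd1] fin [dd [[dd_ge _] lim]].
have dd0 : dd = 0%N.
  by apply/eqP; rewrite -leqn0 leqNgt; apply/negP => lt; apply: nd1; apply: dim_ge_le dd_ge lt.
have [N HN] := lim 1 ltr01.
have := HN (maxn N a) (leq_maxl _ _); rewrite dd0 fact0 mul1r expr0 divr1.
have -> : (\sum_(i < (maxn N a).+1) HF I (Posz i))%N = sumop (fun j => HF I (Posz j)) a.
  by apply: sumop_const => //; apply: leq_maxr.
by rewrite ltr_norml => /andP [_]; rewrite ltrBlDr addrC natr1 ltr_nat ltnS.
Qed.

Lemma homog0_const (K : fieldType) n (p : {mpoly K[n]}) : p \is 0.-homog -> p = (p@_0%MM)%:MP.
Proof.
move=> hp; apply/mpolyP => m; rewrite mcoeffC; case: eqP => [->|/eqP ne].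
  by rewrite mulr1.
by rewrite mulr0 (dhomog_nemf_coeff hp) //= mdeg_eq0.
Qed.

Lemma ideal_unit_const (K : fieldType) n (I : {mpoly K[n]} -> Prop) c :
  is_ideal I -> c != 0 -> I c%:MP -> I 1.
Proof.
move=> iI c0 Ic; have -> : 1 = (c^-1)%:MP * c%:MP :> {mpoly K[n]}.
  by rewrite -mpolyCM mulVf.
exact: idealMl.
Qed.

(** An entry of degree 0 is a constant: a nonzero one generates the unit ideal, and zero can be a
    nonzerodivisor only modulo the unit ideal. *)
Lemma regular_seq_degs_gt0 (K : fieldType) n (fs : seq {mpoly K[n]}) d :
  homog_degs fs d -> regular_seq fs -> all (leq 1) d.
Proof.
move=> [sz hd] /regular_seqP [n1 rfs]; apply/allP => e /(nthP 0%N) [i id <-].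
rewrite -sz in id; rewrite lt0n; apply/eqP => d0; apply: n1.
have := hd i id; rewrite d0 => /homog0_const.
have iZ := (@zero_homog_ideal K n).1.
move=> Ec; case: (eqVneq (fs`_i)@_0%MM 0) => [c0|c0]; last first.
  apply: (ideal_unit_const (add_gens_ideal fs iZ) c0); rewrite -Ec.
  by apply: mem_add_gens => //; apply: mem_nth.
move: rfs; rewrite -{1}(cat_take_drop i fs) (drop_nth 0 id) => /reg_cat [_ [ni _]].
rewrite -(cat_take_drop i fs) add_gens_cat; apply: sub_add_gens; apply: ni.
by rewrite Ec c0 mpolyC0 mulr0; case: (add_gens_ideal (take i fs) iZ).
Qed.

Lemma sigmaE d : all (leq 1) d -> sigma d = Posz (\sum_(e <- d) e.-1).
Proof.
rewrite /sigma; elim: d => [|e d IH] /=; first by rewrite !big_nil.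
by case/andP => e0 /IH E; rewrite !big_cons E; lia.
Qed.

Theorem theorem2p7 (K : fieldType)
  (K_infinite : forall s : seq K, exists x : K, x \notin s)
  (n : nat) (d : seq nat) (D : nat) (fs : seq {mpoly K[n]}) (G : {mpoly K[n]}) :
  is_aci fs G d D ->
  (D%:Z <= sigma d) ->
  exists (fb : seq {mpoly K[size d]}) (Gb : {mpoly K[size d]}),
    [/\ is_aci fb Gb d D,
        artinian (aci_ideal fb Gb),
        (forall j : int,
           (HF (aci_ideal fs G) j
              <= HF (ideal_gen (map (@ext_poly K (size d) n) (rcons fb Gb))) j)%N)
      & (forall e1 e2 : nat, multiplicity_is (aci_ideal fs G) e1 ->
           multiplicity_is (aci_ideal fb Gb) e2 -> (e1 <= e2)%N)].
Proof.
move=> [[szf sd hd rf] [hG nG [_ [P [pP IP nh]]]]] Ds.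
have hfs : homog_degs fs d by [].
have d_gt0 := regular_seq_degs_gt0 hfs rf.
rewrite sigmaE // lez_nat in Ds.
have [_ rfs] := (regular_seqP fs).1 rf.
rewrite ideal_genE in nG.
have aciE m (s : seq {mpoly K[m]}) H : aci_ideal s H = add_gen (add_gens (@zero_ideal K m) s) H.
  by rewrite /aci_ideal ideal_gen_rcons ideal_genE.
rewrite aciE in IP *.
have iZ := (@zero_homog_ideal K n).1; have iP : is_ideal P by case: pP.
(* In degree 0, [G] would be a nonzero constant inside the prime [P]. Positivity of [D] makes [Gb]
   vanish at the origin. *)
have D_gt0 : (0 < D)%N.
  rewrite lt0n; apply/eqP => D0; move: hG; rewrite D0 => /homog0_const EG.
  have [_ P1 _] := pP; apply: P1.
  have PG : P G by apply: IP; apply: mem_add_gen; apply: add_gens_ideal.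
  rewrite EG in PG; apply: ideal_unit_const PG => //.
  apply: contra_notN nG => /eqP c0; rewrite EG c0 mpolyC0.
  by case: (add_gens_ideal fs iZ).
have [hn [fb [Gb [hfb rfb hGb nGb [fin le1 le2]]]]] :=
  artinian_specialization K_infinite hfs d_gt0 rfs hG nG Ds.
have hsfb := homog_degs_seq hfb d_gt0.
have iB := add_gens_ideal fb (@zero_homog_ideal K (size d)).1.
set J := add_gen (add_gens (@zero_ideal K (size d)) fb) Gb.
have iJ : is_ideal J by apply: add_gen_ideal.
have finJ j : (\sum_(e <- d) e.-1 < j)%N -> HF J (Posz j) = 0%N.
  move=> lt; apply/eqP; rewrite -leqn0 -(fin j lt); apply: HF_ideal_mono => // p.
  exact: sub_add_gen.
have Jo : subI J (@origin K (size d)).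
  have -> : J = add_gens (@zero_ideal K (size d)) (rcons fb Gb).
    by rewrite -cats1 add_gens_cat.
  apply: add_gens_origin => x; rewrite mem_rcons inE => /predU1P [->|/hsfb //].
  by exists D.
have artJ : artinian J by apply: artinian_finite finJ.
exists fb, Gb; rewrite aciE -/J; split=> //.
- split; first split=> //; try by case: hfb.
    by apply/regular_seqP; split=> //; apply: add_gens_proper.
  by split=> //; [rewrite ideal_genE | rewrite aciE; apply: height_finite finJ].
- by case=> [j|j] //; rewrite ideal_genE; apply: le1.
move=> e1 e2 m1 m2.
(* The total length of the quotient by [J] separates the two multiplicities; the prime [P] from the
   height hypothesis gives the dimension bound [n - h] for the other side. *)
apply: leq_trans (multiplicity_artinian artJ finJ m2).
apply: (multiplicity_le _ _ le2 m1); last by apply: sumop_le_const.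
exact: dim_ge_of_height pP IP nh.
Qed.
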